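(* Let $(\mathcal V,1)$ be a matrix order unit space, and let $\mathcal L=(L_n)$ be a lower semicontinuous matrix Lipschitz seminorm on $(\mathcal V,1)$. Then $\mathcal L_{\mathcal D_{\mathcal L}}=\mathcal L$, i.e. $L_{D_{L_n}}(a)=L_n(a)$ for all $n\in\mathbb N$ and all $a\in M_n(\mathcal V)$.
   Context: All vector spaces are complex; $M_{m,n}$ denotes the complex $m\times n$ matrices with the operator norm, $M_n=M_{n,n}$, and $1_n\in M_n$ is the identity. For a vector space $V$, $M_n(V)$ is the space of $n\times n$ matrices over $V$, with $v\oplus w$ the block-diagonal sum and $\alpha v\beta$ the usual product with scalar matrices. If $V$ has a conjugate-linear involution $v\mapsto v^*$ (a $*$-vector space), $[v_{ij}]^*=[v_{ji}^*]$. A $*$-vector space $V$ is matrix ordered if each $M_n(V)$ is partially ordered (with cone $M_n(V)^+$) and $\gamma^*M_n(V)^+\gamma\subseteq M_m(V)^+$ for every $\gamma\in M_{n,m}$. A matrix order unit space $(\mathcal V,1)$ is a matrix ordered space with a distinguished order unit $1$ such that $\mathcal V^+$ is a proper cone with order unit $1$ and each $M_n(\mathcal V)^+$ is Archimedean (equivalently, by Choi–Effros, an operator system; completeness is not assumed). Each $M_n(\mathcal V)$ carries the norm $\|v\|_n=\inf\{t:\begin{bmatrix} t1&v\\ v^*&t1\end{bmatrix}\ge 0\}$ (here $1$ is the diagonal matrix with entries $1$). A matrix Lipschitz seminorm $\mathcal L=(L_n)$ on $(\mathcal V,1)$ is a sequence of seminorms $L_n:M_n(\mathcal V)\to[0,+\infty)$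 such that for all $v\in M_m(\mathcal V)$, $w\in M_n(\mathcal V)$, $\alpha\in M_{n,m}$, $\beta\in M_{m,n}$: (1) the null space of $L_n$ is $M_n(\mathbb C1)$; (2) $L_{m+n}(v\oplus w)=\max\{L_m(v),L_n(w)\}$; (3) $L_n(\alpha v\beta)\le\|\alpha\|L_m(v)\|\beta\|$; (4) $L_m(v^* )=L_m(v)$. It is lower semicontinuous if each $L_n$ is lower semicontinuous, i.e. $\{a\in M_n(\mathcal V):L_n(a)\le t\}$ is norm closed for one (hence every) $t>0$. $CS_n(\mathcal V)$ is the set of completely positive (completely bounded) linear maps $\varphi:\mathcal V\to M_n$ with $\varphi(1)=1_n$. For $\varphi=[\varphi_{kl}]:\mathcal V\to M_r$ and $a=[a_{ij}]\in M_n(\mathcal V)$, $\ll\varphi,a\gg=[\varphi_{kl}(a_{ij})]\in M_{rn}$ is the matrix pairing. Define, for $\varphi,\psi\in CS_n(\mathcal V)$, $$D_{L_n}(\varphi,\psi)=\sup\{\|\ll\varphi,a\gg-\ll\psi,a\gg\|: a\in M_r(\mathcal V),\ L_r(a)\le1,\ r\in\mathbb N\}\in[0,+\infty],$$ $\mathcal D_{\mathcal L}=(D_{L_n})$, and for $a\in M_n(\mathcal V)$ $$L_{D_{L_n}}(a)=\sup\Big\{\frac{\|\ll\varphi,a\gg-\ll\psi,a\gg\|}{D_{L_r}(\varphi,\psi)}:\varphi,\psi\in CS_r(\mathcal V),\ \varphi\ne\psi,\ r\in\mathbb N\Big\},$$ with $c/(+\infty)=0$; $\mathcal L_{\mathcal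 D_{\mathcal L}}=(L_{D_{L_n}})$. *)

(* Defs.v *)
From mathcomp Require Import all_boot all_order all_algebra.
From mathcomp Require Import sesquilinear spectral.
From mathcomp Require Import complex mxtens.
From mathcomp Require Import boolp classical_sets reals constructive_ereal ereal.

Set Implicit Arguments.
Unset Strict Implicit.
Unset Printing Implicit Defensive.

Import Order.TTheory GRing.Theory Num.Theory.

Local Open Scope classical_set_scope.
Local Open Scope complex_scope.
Local Open Scope ring_scope.
Local Open Scope sesquilinear_scope.

Section ComplexMatrices.
Context {R : realType}.
Local Notation C := R[i].

Definition l2norm n (x : 'cV[C]_n) : R :=
  Num.sqrt (\sum_(i < n) Normc.normc (x i 0) ^+ 2).

Definition opnorm m n (A : 'M[C]_(m, n)) : R :=
  sup [set l2norm (A *m x) | x in [set x : 'cV[C]_n | l2norm x <= 1]].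

(* In [R[i]], [0 <= z] says that [z] is real and nonnegative, so this is
   positivity of the operator [A]; in particular [A] is Hermitian. *)
Definition psdmx n (A : 'M[C]_n) : Prop :=
  forall x : 'cV[C]_n, 0 <= (x^t* *m A *m x) 0 0.

End ComplexMatrices.

Section MatricesOverSpace.
Context {R : realType} {V : lmodType R[i]}.
Local Notation C := R[i].

Definition lmulsmx m n p (al : 'M[C]_(m, n)) (v : 'M[V]_(n, p)) : 'M[V]_(m, p) :=
  \matrix_(i, j) \sum_k al i k *: v k j.

Definition rmulsmx m n p (v : 'M[V]_(m, n)) (be : 'M[C]_(n, p)) : 'M[V]_(m, p) :=
  \matrix_(i, j) \sum_k be k j *: v i k.

Definition scalesmx m n (c : C) (v : 'M[V]_(m, n)) : 'M[V]_(m, n) :=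
  map_mx ( *:%R c) v.

Definition starmx (star : V -> V) m n (v : 'M[V]_(m, n)) : 'M[V]_(n, m) :=
  map_mx star v^T.

End MatricesOverSpace.

Section MatrixOrder.
Context {R : realType} {V : lmodType R[i]}.
Local Notation C := R[i].
Implicit Types (star : V -> V) (pos : forall n, set 'M[V]_n) (e : V).

Definition is_involution star : Prop :=
  (forall v, star (star v) = v) /\
  (forall (c : C) u v, star (c *: u + v) = c^*%R *: star u + star v).

(* The cone of a (partial, hence antisymmetric) order on the self-adjoint
   elements of [M_n(V)]. *)
Record is_proper_cone star n (K : set 'M[V]_n) : Prop := {
  cone_selfadjoint : forall v, K v -> starmx star v = v ;
  cone0 : K 0 ;
  coneD : forall v w, K v -> K w -> K (v + w) ;
  coneZ : forall (t : R) v, 0 <= t -> K v -> K (scalesmx t%:C v) ;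
  cone_proper : forall v, K v -> K (- v) -> v = 0 }.

Record is_matrix_ordered star pos : Prop := {
  mo_star : is_involution star ;
  mo_cone : forall n, (0 < n)%N -> is_proper_cone star (pos n) ;
  mo_conj : forall m n (ga : 'M[C]_(n, m)) v, (0 < m)%N -> (0 < n)%N ->
    pos n v -> pos m (rmulsmx (lmulsmx (ga^t*) v) ga) }.

(* [V] is identified with [M_1(V)] through [v |-> v%:M]. *)
Definition is_order_unit star pos e : Prop :=
  star e = e /\
  forall v, star v = v ->
    exists2 t : R, 0 < t & pos 1%N (t%:C *: e + v)%:M.

Definition is_archimedean pos e n : Prop :=
  forall v : 'M[V]_n,
    (forall t : R, 0 < t -> pos n ((t%:C *: e)%:M + v)) -> pos n v.

End MatrixOrder.

(* Matrix spaces are indexed by positive integers: the values at size [0] of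
   the families below are irrelevant, and every axiom and every supremum is
   restricted to positive sizes. *)
Record matrixOrderUnitSpace (R : realType) := MatrixOrderUnitSpace {
  mou_sort :> lmodType R[i] ;
  mou_star : mou_sort -> mou_sort ;
  mou_pos : forall n, set 'M[mou_sort]_n ;
  mou_unit : mou_sort ;
  mou_matrix_ordered : is_matrix_ordered mou_star mou_pos ;
  mou_order_unit : is_order_unit mou_star mou_pos mou_unit ;
  mou_archimedean : forall n, (0 < n)%N -> is_archimedean mou_pos mou_unit n }.

Arguments mou_star {R m}.
Arguments mou_pos {R m n}.
Arguments mou_unit {R m}.

Section Lipschitz.
Context {R : realType} {V : matrixOrderUnitSpace R}.
Local Notation C := R[i].
Local Notation star := (@mou_star R V).
Local Notation pos := (@mou_pos R V _).
Local Notation e := (@mou_unit R V).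

Definition mnorm n (v : 'M[V]_n) : R :=
  inf [set t : R | pos (block_mx (t%:C *: e)%:M v
                                 (starmx star v) (t%:C *: e)%:M)].

Definition norm_closed n (A : set 'M[V]_n) : Prop :=
  forall a, (forall eps : R, 0 < eps -> exists2 b, A b & mnorm (a - b) < eps) ->
    A a.

Definition is_seminorm n (p : 'M[V]_n -> R) : Prop :=
  [/\ forall v, 0 <= p v,
      forall v w, p (v + w) <= p v + p w &
      forall (c : C) v, p (scalesmx c v) = Normc.normc c * p v].

Record matrix_lipschitz_seminorm (L : forall n, 'M[V]_n -> R) : Prop := {
  mls_seminorm : forall n, (0 < n)%N -> is_seminorm (L n) ;
  mls_null : forall n (v : 'M[V]_n), (0 < n)%N ->
    L n v = 0 <-> exists A : 'M[C]_n, v = map_mx (fun c => c *: e) A ;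
  mls_dsum : forall m n (v : 'M[V]_m) (w : 'M[V]_n), (0 < m)%N -> (0 < n)%N ->
    L (m + n)%N (block_mx v 0 0 w) = Num.max (L m v) (L n w) ;
  mls_mul : forall m n (v : 'M[V]_m) (al : 'M[C]_(n, m)) (be : 'M[C]_(m, n)),
    (0 < m)%N -> (0 < n)%N ->
    L n (rmulsmx (lmulsmx al v) be) <= opnorm al * L m v * opnorm be ;
  mls_star : forall m (v : 'M[V]_m), (0 < m)%N -> L m (starmx star v) = L m v }.

Definition lower_semicontinuous_seminorm (L : forall n, 'M[V]_n -> R) : Prop :=
  forall n (t : R), (0 < n)%N -> 0 < t -> norm_closed [set a | L n a <= t].

(* The matrix pairing [<<phi, a>>], which is also the amplification
   [phi_n(a) = [phi (a i j)]] under [M_n(M_r) = M_(n * r)]; the index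
   [i * r + k] of ['I_(n * r)] stands for the pair [(i, k)]. *)
Definition mx_pairing r n (phi : V -> 'M[C]_r) (a : 'M[V]_n) : 'M[C]_(n * r) :=
  \matrix_(p, q)
    phi (a (mxtens_unindex p).1 (mxtens_unindex q).1)
        (mxtens_unindex p).2 (mxtens_unindex q).2.

Definition completely_positive r (phi : V -> 'M[C]_r) : Prop :=
  forall n (a : 'M[V]_n), (0 < n)%N -> pos a -> psdmx (mx_pairing phi a).

Definition completely_bounded r (phi : V -> 'M[C]_r) : Prop :=
  exists K : R, forall n (a : 'M[V]_n), (0 < n)%N ->
    opnorm (mx_pairing phi a) <= K * mnorm a.

Definition matrix_state r : set {linear V -> 'M[C]_r} :=
  [set phi : {linear V -> 'M[C]_r} |
    [/\ completely_positive phi, completely_bounded phi & phi e = 1%:M]].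

(* Supremum in [[0, +oo]], where the empty set has supremum [0]. *)
Definition nneg_sup (A : set (\bar R)) : \bar R := maxe 0%E (ereal_sup A).

Definition matrix_metric (L : forall n, 'M[V]_n -> R)
    r (phi psi : {linear V -> 'M[C]_r}) : \bar R :=
  nneg_sup [set x | exists n (a : 'M[V]_n),
    [/\ (0 < n)%N, L n a <= 1 &
        x = (opnorm (mx_pairing phi a - mx_pairing psi a))%:E]].

(* The library's division satisfies [x%:E / +oo = 0]. *)
Definition lipschitz_of_metric
    (D : forall r, {linear V -> 'M[C]_r} -> {linear V -> 'M[C]_r} -> \bar R)
    n (a : 'M[V]_n) : \bar R :=
  nneg_sup [set x | exists r (phi psi : {linear V -> 'M[C]_r}),
    [/\ (0 < r)%N, matrix_state phi, matrix_state psi,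
        phi <> psi :> (V -> 'M[C]_r) &
        x = ((opnorm (mx_pairing phi a - mx_pairing psi a))%:E
               / D r phi psi)%E]].

End Lipschitz.

(* Main.v *)
From HB Require Import structures.
Require Import Defs.
From mathcomp Require Import all_boot all_order all_algebra.
From mathcomp Require Import sesquilinear spectral.
From mathcomp Require Import complex mxtens.
From mathcomp Require Import boolp classical_sets reals constructive_ereal ereal.
From mathcomp Require unstable.
From mathcomp Require Import ring lra.

(** Write [<<f, a>>] for the matrix pairing. That the difference quotients of
    [a] are at most [L a] is immediate from the definition of the metric, since
    two states agree on the multiples of the unit, where [L] vanishes
    ([lipschitz_of_metric_le]). The converse is a bipolar theorem: the unit ball
    of [L] is closed and stable under the products [al^* v be], so when
    [t < L a] it can be separated from [a] by a matrix-valued map.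

    The separation is obtained from one application of Krein's theorem
    ([cone_separation]), which yields at the same time the map, its
    decomposition into two positive parts, and the normalization of its norm.
    A linear map [f : V -> M_N] is encoded by a scalar functional [F] on
    [M_N(V)] ([functional_of]), for which [<<f, v>>] has the form
    [<<<f, v>> Y, X> = F(X^* v Y)], the vectors [X] and [Y] being seen as
    matrices with [N] columns ([pairing_form]). Thus [f] is completely positive
    exactly when [F] is positive, and [<<f, v>>] has norm at most [1] exactly
    when [2 Re F(X^* v Y) <= |X|^2 + |Y|^2] in Hilbert--Schmidt norms.

    Consider, on [M_N(V) x M_N(V) x M_N], the cone of the [(x, y, h)] such that
    (up to taking self-adjoint parts) [x + k], [y - k] and [h - c] are positive
    for some [k = al^* v be], [c = al^* al + be^* be] with [L v <= 1]. By the
    direct sum axiom this is a convex cone, and it has an order unit. A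
    functional positive on it is a triple [(F1, F2, P)] of positive functionals
    with [2 Re (F1 - F2)(al^* v be) <= P(al^* al + be^* be)]. In order to cope
    with an [a] which is not self-adjoint, take [N = 2 n] and place [a] in the
    off-diagonal corner of a two by two block matrix; lower semicontinuity keeps
    the corresponding point outside the cone ([separation_cone_target]).

    After a small perturbation the density matrix of [P] is [S^* S] with [S]
    invertible ([psdmx_add_scalar_factor]). Conjugating [F1] and [F2] by
    the inverse of [S^*] turns the bound by [P] into the bound by the
    Hilbert--Schmidt norm, so the associated maps [f] and [g] are
    completely positive with [<<f - g, .>>] contractive on the unit ball of [L]
    and of norm greater than [t] at [a] ([separating_maps]). Finally [f] and [g]
    agree on the unit, so a small multiple of both becomes unital after the
    addition of one and the same completely positive map ([ex_states]). This
    multiplies [f - g] by a constant [c]: the distance of the two states is at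
    most [c], and their pairings with [a] differ by more than [c t]. *)

Set Implicit Arguments.
Unset Strict Implicit.
Unset Printing Implicit Defensive.

Import Order.TTheory GRing.Theory Num.Theory.

Local Open Scope classical_set_scope.
Local Open Scope complex_scope.
Local Open Scope ring_scope.
Local Open Scope sesquilinear_scope.

(** * The operator norm and the Hilbert--Schmidt norm *)

Section ComplexNumbers.
Context {R : realType}.
Local Notation C := R[i].
Local Notation Re := (@complex.Re R).
Local Notation Im := (@complex.Im R).
Implicit Types z w : C.

Lemma ReD z w : Re (z + w) = Re z + Re w. Proof. by case: z w => ? ? []. Qed.
Lemma ReN z : Re (- z) = - Re z. Proof. by case: z. Qed.
Lemma ReZ (t : R) z : Re (t%:C * z) = t * Re z.
Proof. by case: z => a b /=; rewrite mul0r subr0. Qed.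
Lemma Re_real (t : R) : Re t%:C = t. Proof. by []. Qed.

Lemma conjC_conjc z : z^*%R = conjc z.
Proof.
have : z * z^*%R = z * conjc z by rewrite -normCK sqr_normc.
have [->|z0] := eqVneq z 0; first by rewrite rmorph0 conjc0.
exact: mulfI.
Qed.

Lemma Re_conjc z : Re z^*%R = Re z.
Proof. by rewrite conjC_conjc; case: z. Qed.

Lemma conj_real (t : R) : (t%:C)^*%R = t%:C.
Proof. by rewrite conjC_conjc conjc_real. Qed.

Lemma normC_normc z : `|z| = (Normc.normc z)%:C.
Proof. by rewrite normc_def; case: z. Qed.

Lemma normc_ge0 z : 0 <= Normc.normc z.
Proof. by rewrite -ler0c -normC_normc. Qed.

Lemma normc_sq z : (Normc.normc z ^+ 2)%:C = z^*%R * z.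
Proof. by rewrite rmorphXn /= -normC_normc normCK mulrC. Qed.

Lemma normc_sqB z w :
  Normc.normc (z - w) ^+ 2 =
  Normc.normc z ^+ 2 + Normc.normc w ^+ 2 - 2 * Re (z^*%R * w).
Proof.
rewrite conjC_conjc; case: z w => a b [c d] /=.
by rewrite !sqr_sqrtr ?addr_ge0 ?sqr_ge0 //; ring.
Qed.

Lemma Re_sum (I : Type) (r : seq I) (P : pred I) (F : I -> C) :
  Re (\sum_(i <- r | P i) F i) = \sum_(i <- r | P i) Re (F i).
Proof. by elim/big_rec2: _ => // i x y _ <-; rewrite ReD. Qed.

Lemma ge0_Re z : 0 <= z -> 0 <= Re z.
Proof. by rewrite lecE => /andP[]. Qed.

Lemma ge0P z : 0 <= Re z -> Im z = 0 -> 0 <= z.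
Proof. by rewrite lecE => -> ->; rewrite eqxx. Qed.

End ComplexNumbers.

Section HilbertSchmidt.
Context {R : realType}.
Local Notation C := R[i].
Local Notation Re := (@complex.Re R).

Definition hsnorm2 m n (X : 'M[C]_(m, n)) : R :=
  \sum_i \sum_j Normc.normc (X i j) ^+ 2.

Lemma adjmxM m n p (A : 'M[C]_(m, n)) (B : 'M[C]_(n, p)) :
  (A *m B)^t* = B^t* *m A^t*.
Proof. by rewrite trmx_mul map_mxM. Qed.

Lemma adjmxD m n (A B : 'M[C]_(m, n)) : (A + B)^t* = A^t* + B^t*.
Proof. by rewrite linearD map_mxD. Qed.

Lemma adjmxZ m n c (A : 'M[C]_(m, n)) : (c *: A)^t* = c^*%R *: A^t*.
Proof. by rewrite linearZ map_mxZ. Qed.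

Lemma adjmx1 n : (1%:M : 'M[C]_n)^t* = 1%:M.
Proof. by rewrite trmx1 map_mx1. Qed.

Lemma hsnorm2_ge0 m n (X : 'M[C]_(m, n)) : 0 <= hsnorm2 X.
Proof. by do 2!(apply: sumr_ge0 => ? _); rewrite sqr_ge0. Qed.

Lemma mxtrace_adjM m n (X Y : 'M[C]_(m, n)) :
  \tr (X^t* *m Y) = \sum_i \sum_j (X i j)^*%R * Y i j.
Proof.
rewrite exchange_big /mxtrace; apply: eq_bigr => j _; rewrite mxE.
by apply: eq_bigr => i _; rewrite !mxE.
Qed.

Lemma hsnorm2E m n (X : 'M[C]_(m, n)) : (hsnorm2 X)%:C = \tr (X^t* *m X).
Proof.
rewrite mxtrace_adjM /hsnorm2 rmorph_sum; apply: eq_bigr => i _.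
by rewrite rmorph_sum; apply: eq_bigr => j _; rewrite -normc_sq.
Qed.

Lemma hsnorm2B m n (X Y : 'M[C]_(m, n)) :
  hsnorm2 (X - Y) = hsnorm2 X + hsnorm2 Y - 2 * Re (\tr (X^t* *m Y)).
Proof.
rewrite mxtrace_adjM /hsnorm2 Re_sum mulr_sumr -!big_split /= -sumrB.
apply: eq_bigr => i _; rewrite Re_sum mulr_sumr -!big_split /= -sumrB.
by apply: eq_bigr => j _; rewrite !mxE normc_sqB.
Qed.

Lemma Re_mxtrace_adjM_le m n (X Y : 'M[C]_(m, n)) :
  2 * Re (\tr (X^t* *m Y)) <= hsnorm2 X + hsnorm2 Y.
Proof. by have := hsnorm2_ge0 (X - Y); rewrite hsnorm2B subr_ge0. Qed.

Lemma hsnorm2Z m n c (X : 'M[C]_(m, n)) :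
  hsnorm2 (c *: X) = Normc.normc c ^+ 2 * hsnorm2 X.
Proof.
rewrite /hsnorm2 mulr_sumr; apply: eq_bigr => i _; rewrite mulr_sumr.
by apply: eq_bigr => j _; rewrite !mxE Normc.normcM exprMn.
Qed.

Lemma hsnorm2_eq0 m n (X : 'M[C]_(m, n)) : hsnorm2 X = 0 -> X = 0.
Proof.
move=> X0; apply/matrixP => i j; rewrite mxE; apply: Normc.eq0_normc.
apply/eqP; rewrite -[_ == _](expf_eq0 _ 2); apply/eqP.
have ge0 k : 0 <= \sum_l Normc.normc (X k l) ^+ 2.
  by apply: sumr_ge0 => ? _; rewrite sqr_ge0.
have Xi := psumr_eq0P (fun k _ => ge0 k) X0 (i := i) isT.
by apply: (psumr_eq0P _ Xi) => // k _; rewrite sqr_ge0.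
Qed.

Lemma hsnorm2_0 m n : hsnorm2 (0 : 'M[C]_(m, n)) = 0.
Proof. by rewrite -[X in hsnorm2 X](scale0r 0) hsnorm2Z Normc.normc0 expr0n mul0r. Qed.

Lemma l2norm_hsnorm2 n (x : 'cV[C]_n) : l2norm x = Num.sqrt (hsnorm2 x).
Proof.
by rewrite /l2norm; congr Num.sqrt; apply: eq_bigr => i _; rewrite big_ord1.
Qed.

Lemma l2norm_le n (x : 'cV[C]_n) K : 0 <= K ->
  (l2norm x <= K) = (hsnorm2 x <= K ^+ 2).
Proof.
move=> K0; rewrite l2norm_hsnorm2 -[X in _ <= X]ger0_norm // -sqrtr_sqr.
by rewrite ler_sqrt // sqr_ge0.
Qed.

Lemma mxtrace_form m n (A : 'M[C]_(m, n)) (x : 'cV[C]_m) (y : 'cV[C]_n) :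
  (x^t* *m A *m y) 0 0 = \tr (x^t* *m (A *m y)).
Proof. by rewrite -mulmxA trace_mx11. Qed.

(** The set whose supremum defines the operator norm is bounded: each entry of
    [A *m x] is at most the sum of the moduli of the corresponding row. *)
Lemma mulmx_bounded m n (A : 'M[C]_(m, n)) :
  exists2 K : R, 0 <= K &
    forall x : 'cV[C]_n, l2norm x <= 1 -> l2norm (A *m x) <= K.
Proof.
pose s i := \sum_j Normc.normc (A i j).
have s0 i : 0 <= s i by apply: sumr_ge0 => ? _; exact: normc_ge0.
exists (Num.sqrt (\sum_i s i ^+ 2)); first exact: sqrtr_ge0.
move=> x; rewrite l2norm_le // expr1n => x1.
rewrite l2norm_hsnorm2; apply: ler_wsqrtr; apply: ler_sum => i _.
rewrite big_ord1 ler_sqr ?nnegrE ?normc_ge0 //.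
have xj j : Normc.normc (x j 0) <= 1.
  rewrite -(@ler_pXn2r _ 2) ?nnegrE ?normc_ge0 // expr1n.
  apply: le_trans x1; rewrite /hsnorm2 (bigD1 j) //= big_ord1 lerDl.
  by do 2!(apply: sumr_ge0 => ? _); rewrite sqr_ge0.
rewrite mxE; apply: le_trans (_ : \sum_j Normc.normc (A i j * x j 0) <= _).
  elim/big_rec2: _ => [|j a b _ ab]; first by rewrite Normc.normc0.
  by apply: le_trans (le_normcD _ _) _; rewrite lerD2l.
apply: ler_sum => j _; rewrite Normc.normcM -[leRHS]mulr1.
by rewrite ler_wpM2l ?normc_ge0.
Qed.

Lemma l2norm_mulmx_le m n (A : 'M[C]_(m, n)) (x : 'cV[C]_n) :
  l2norm x <= 1 -> l2norm (A *m x) <= opnorm A.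
Proof.
move=> x1; apply: sup_upper_bound; last by exists x.
have l0 : l2norm (0 : 'cV[C]_n) <= 1 by rewrite l2norm_le // hsnorm2_0 expr1n.
have [K _ AK] := mulmx_bounded A.
split; first by exists (l2norm (A *m 0)), 0.
by exists K => _ [y /= /AK yK <-].
Qed.

Lemma opnorm_ge0 m n (A : 'M[C]_(m, n)) : 0 <= opnorm A.
Proof.
apply: le_trans (l2norm_mulmx_le A (_ : l2norm 0 <= 1)).
  by rewrite l2norm_hsnorm2 sqrtr_ge0.
by rewrite l2norm_le // hsnorm2_0 expr1n.
Qed.

Lemma hsnorm2_mulmx_le m n (A : 'M[C]_(m, n)) (x : 'cV[C]_n) :
  hsnorm2 (A *m x) <= opnorm A ^+ 2 * hsnorm2 x.
Proof.
have [/hsnorm2_eq0 ->|x0] := eqVneq (hsnorm2 x) 0.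
  by rewrite mulmx0 !hsnorm2_0 mulr0.
have xgt0 : 0 < hsnorm2 x by rewrite lt_neqAle eq_sym x0 hsnorm2_ge0.
pose s := Num.sqrt (hsnorm2 x).
have s2 : s ^+ 2 = hsnorm2 x by rewrite sqr_sqrtr ?ltW.
have s0 : 0 < s by rewrite sqrtr_gt0.
pose y := (s^-1)%:C *: x.
have normcs : Normc.normc (s^-1)%:C = s^-1.
  by rewrite /= expr0n addr0 sqrtr_sqr ger0_norm // invr_ge0 ltW.
have y1 : hsnorm2 y = 1.
  by rewrite hsnorm2Z normcs exprVn s2 mulVf.
have := @l2norm_mulmx_le _ _ A y.
rewrite !l2norm_le ?opnorm_ge0 // expr1n y1 => /(_ (lexx _)).
by rewrite -scalemxAr hsnorm2Z normcs exprVn s2 mulrC ler_pdivrMr.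
Qed.

Lemma opnorm_le m n (A : 'M[C]_(m, n)) K : 0 <= K ->
  (forall x : 'cV[C]_n, hsnorm2 (A *m x) <= K ^+ 2 * hsnorm2 x) -> opnorm A <= K.
Proof.
move=> K0 AK; apply: ge_sup.
  exists (l2norm (A *m 0)), 0 => //=; by rewrite l2norm_le // hsnorm2_0 expr1n.
move=> _ [x /= x1 <-]; rewrite l2norm_le //; apply: le_trans (AK x) _.
rewrite -[leRHS]mulr1 ler_wpM2l ?sqr_ge0 //.
by rewrite l2norm_le // expr1n in x1.
Qed.

(** The operator norm as a bound on the sesquilinear form: this version is
    symmetric in the two vectors, so it is insensitive to adjoints, and it turns
    norm bounds into statements about positivity. *)
Lemma opnorm_formP m n (A : 'M[C]_(m, n)) K : 0 <= K ->
  opnorm A <= K <-> forall (x : 'cV[C]_m) (y : 'cV[C]_n),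
    2 * Re ((x^t* *m A *m y) 0 0) <= K * (hsnorm2 x + hsnorm2 y).
Proof.
move=> K0; split=> [AK x y|AK].
  rewrite mxtrace_form; have [K_0|Kn0] := eqVneq K 0.
    have := hsnorm2_mulmx_le A y.
    have -> : opnorm A = 0.
      by apply/eqP; rewrite eq_le opnorm_ge0 andbT -K_0.
    rewrite expr0n mul0r => Ay0.
    have -> : A *m y = 0.
      by apply: hsnorm2_eq0; apply/eqP; rewrite eq_le Ay0 hsnorm2_ge0.
    by rewrite mulmx0 raddf0 mulr0 K_0 mul0r.
  have Kp : 0 < K by rewrite lt_neqAle eq_sym Kn0.
  have := Re_mxtrace_adjM_le (K%:C *: x) (A *m y).
  rewrite adjmxZ conj_real -scalemxAl linearZ /= ReZ hsnorm2Z.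
  rewrite [Normc.normc _]/= expr0n addr0 sqr_sqrtr ?sqr_ge0 // => le1.
  have le2 : hsnorm2 (A *m y) <= K ^+ 2 * hsnorm2 y.
    apply: le_trans (hsnorm2_mulmx_le A y) _.
    by rewrite ler_wpM2r ?hsnorm2_ge0 // ler_sqr ?nnegrE ?opnorm_ge0.
  rewrite -(ler_pM2l Kp); apply: le_trans (_ : _ <= K ^+ 2 * hsnorm2 x +
    K ^+ 2 * hsnorm2 y) _; last by rewrite -mulrDr expr2 mulrA.
  rewrite mulrCA; apply: le_trans le1 _; by rewrite lerD2l.
(* Conversely, test the form at [x = A y / K]. *)
apply: opnorm_le => // y; set w := A *m y.
have [->|w0] := eqVneq (hsnorm2 w) 0.
  by rewrite mulr_ge0 ?sqr_ge0 ?hsnorm2_ge0.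
have wgt0 : 0 < hsnorm2 w by rewrite lt_neqAle eq_sym w0 hsnorm2_ge0.
have Aw s : 2 * (s * hsnorm2 w) <= K * (s ^+ 2 * hsnorm2 w + hsnorm2 y).
  have := AK (s%:C *: w) y.
  rewrite mxtrace_form adjmxZ conj_real -scalemxAl linearZ /= -/w -hsnorm2E.
  rewrite ReZ Re_real hsnorm2Z [Normc.normc _]/= expr0n addr0.
  by rewrite sqr_sqrtr ?sqr_ge0.
have [K_0|Kn0] := eqVneq K 0.
  by have := Aw 1; rewrite K_0 expr0n !mul0r mul1r pmulr_rle0.
have := Aw K^-1; have Kp : 0 < K by rewrite lt_neqAle eq_sym Kn0.
rewrite mulrDr mulrA -(ler_pM2l Kp).
have -> : K * (2 * K^-1 * hsnorm2 w) = 2 * hsnorm2 w by field.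
have -> : K * (K * (K^-1 ^+ 2 * hsnorm2 w) + K * hsnorm2 y) =
  hsnorm2 w + K ^+ 2 * hsnorm2 y by field.
by move=> ?; lra.
Qed.

Lemma opnorm_adj_le m n (A : 'M[C]_(m, n)) K : 0 <= K ->
  opnorm A <= K -> opnorm (A^t*) <= K.
Proof.
move=> K0 /opnorm_formP AK; apply/opnorm_formP => // x y.
rewrite addrC; apply: le_trans (AK K0 y x).
rewrite -[X in X <= _](_ : 2 * Re ((x^t* *m A^t* *m y)^t* 0 0) = _).
  by rewrite !adjmxM !trmxCK mulmxA.
by rewrite !mxE Re_conjc.
Qed.

Lemma opnorm0_eq0 m n (A : 'M[C]_(m, n)) : opnorm A <= 0 -> A = 0.
Proof.
move=> A0; apply/matrixP => i j.
have : A *m delta_mx j (0 : 'I_1) = 0.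
  apply: hsnorm2_eq0; apply/eqP; rewrite eq_le hsnorm2_ge0 andbT.
  apply: le_trans (hsnorm2_mulmx_le _ _) _.
  have -> : opnorm A = 0 by apply/eqP; rewrite eq_le A0 opnorm_ge0.
  by rewrite expr0n mul0r.
by rewrite -colE => /colP/(_ i); rewrite !mxE.
Qed.

End HilbertSchmidt.

(** * Positive matrices *)

Section PositiveMatrices.
Context {R : realType}.
Local Notation C := R[i].
Local Notation Re := (@complex.Re R).

Definition mxform m n (A : 'M[C]_(m, n)) (x : 'cV[C]_m) (y : 'cV[C]_n) : C :=
  (x^t* *m A *m y) 0 0.

Lemma mxformDl m n (A : 'M[C]_(m, n)) x x' y :
  mxform A (x + x') y = mxform A x y + mxform A x' y.
Proof. by rewrite /mxform adjmxD !mulmxDl mxE. Qed.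

Lemma mxformDr m n (A : 'M[C]_(m, n)) x y y' :
  mxform A x (y + y') = mxform A x y + mxform A x y'.
Proof. by rewrite /mxform mulmxDr mxE. Qed.

Lemma mxformZl m n (A : 'M[C]_(m, n)) c x y :
  mxform A (c *: x) y = c^*%R * mxform A x y.
Proof. by rewrite /mxform adjmxZ -!scalemxAl mxE. Qed.

Lemma mxformZr m n (A : 'M[C]_(m, n)) c x y : mxform A x (c *: y) = c * mxform A x y.
Proof. by rewrite /mxform -scalemxAr mxE. Qed.

Lemma mxformD m n (A B : 'M[C]_(m, n)) x y :
  mxform (A + B) x y = mxform A x y + mxform B x y.
Proof. by rewrite /mxform mulmxDr mulmxDl mxE. Qed.

Lemma mxformZ m n c (A : 'M[C]_(m, n)) x y : mxform (c *: A) x y = c * mxform A x y.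
Proof. by rewrite /mxform -scalemxAr -scalemxAl mxE. Qed.

Lemma mxformN m n (A : 'M[C]_(m, n)) x y : mxform (- A) x y = - mxform A x y.
Proof. by rewrite -scaleN1r mxformZ mulN1r. Qed.

Lemma mxform_delta m n (A : 'M[C]_(m, n)) i j :
  mxform A (delta_mx i 0) (delta_mx j 0) = A i j.
Proof. by rewrite /mxform trmx_delta map_delta_mx -rowE -colE !mxE. Qed.

Lemma mxform1 n (x : 'cV[C]_n) : mxform 1%:M x x = (hsnorm2 x)%:C.
Proof. by rewrite /mxform mulmx1 hsnorm2E trace_mx11. Qed.

Lemma mxform_gram m n (T : 'M[C]_(m, n)) x :
  mxform (T^t* *m T) x x = (hsnorm2 (T *m x))%:C.
Proof. by rewrite hsnorm2E trace_mx11 /mxform adjmxM !mulmxA. Qed.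

Lemma mxform_adj m n (A : 'M[C]_(m, n)) x y : mxform (A^t*) x y = (mxform A y x)^*%R.
Proof.
rewrite /mxform (_ : x^t* *m A^t* *m y = (y^t* *m A *m x)^t*); first by rewrite 2!mxE.
by rewrite !adjmxM trmxCK mulmxA.
Qed.

(** Polarization: over the complex numbers a matrix is determined by its
    quadratic form. *)
Lemma mxform_eq0 n (H : 'M[C]_n) : (forall x, mxform H x x = 0) -> H = 0.
Proof.
move=> H0; have diag i : H i i = 0 by rewrite -mxform_delta.
have off (c : C) i j : c * H i j + c^*%R * H j i = 0.
  have := H0 (delta_mx i 0 + c *: delta_mx j 0).
  rewrite mxformDl !mxformDr mxformZl !mxformZr mxformZl !mxform_delta !diag.
  by rewrite !mulr0 addr0 add0r.
apply/matrixP => i j; rewrite [RHS]mxE.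
have := off 1 i j; have := off 'i%R i j.
rewrite rmorph1 conjCi !mul1r mulNr -mulrBr => /eqP.
rewrite mulf_eq0 (negbTE (neq0Ci _)) /= subr_eq0 => /eqP <- /eqP.
by rewrite -mulr2n mulrn_eq0 /= => /eqP.
Qed.

Lemma psdmx_adj n (B : 'M[C]_n) : psdmx B -> B^t* = B.
Proof.
move=> Bpsd; apply/eqP; rewrite eq_sym -subr_eq0; apply/eqP.
apply: mxform_eq0 => x; rewrite mxformD mxformN mxform_adj.
have /ger0_real/CrealP -> : 0 <= mxform B x x by exact: Bpsd.
by rewrite subrr.
Qed.

(** Diagonalize by the spectral theorem and take the square roots of the
    eigenvalues. *)
Lemma psdmx_factor n (B : 'M[C]_n) :
  psdmx B -> exists T : 'M[C]_n, B = T^t* *m T.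
Proof.
move=> Bpsd; have Badj := psdmx_adj Bpsd.
have /hermitian_normalmx/orthomx_spectralP : B \is hermsymmx.
  by apply/is_hermitianmxP; rewrite expr0 scale1r Badj.
set P := spectralmx B; set d := spectral_diag B => BE.
have Pu : P \is unitarymx := spectral_unitarymx B.
rewrite invmx_unitary // in BE.
have PP : P *m P^t* = 1%:M by apply/unitarymxP.
have d0 i : 0 <= d 0 i.
  have := Bpsd (P^t* *m delta_mx i 0).
  rewrite BE adjmxM trmxCK !mulmxA -(mulmxA _ P (P^t*)) PP mulmx1.
  rewrite -[_ *m P *m P^t*]mulmxA PP mulmx1 trmx_delta map_delta_mx.
  by rewrite -rowE -colE !mxE eqxx mulr1n.
exists (diag_mx (map_mx sqrtC d) *m P).
rewrite adjmxM mulmxA -[X in X *m P]mulmxA {1}BE; congr (_ *m _).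
congr (_ *m _); apply/matrixP => i j; rewrite tr_diag_mx map_diag_mx mul_diag_mx.
rewrite !mxE; case: eqVneq => [->|]; rewrite ?mulr0n ?mulr0 // !mulr1n.
by rewrite -normCKC ger0_norm ?sqrtC_ge0 // sqrtCK.
Qed.

Lemma psdmx_gram m n (T : 'M[C]_(m, n)) : psdmx (T^t* *m T).
Proof. by move=> x; rewrite -/(mxform _ x x) mxform_gram ler0c hsnorm2_ge0. Qed.

Lemma psdmxD n (A B : 'M[C]_n) : psdmx A -> psdmx B -> psdmx (A + B).
Proof.
by move=> A0 B0 x; rewrite -/(mxform _ x x) mxformD; exact: addr_ge0 (A0 x) (B0 x).
Qed.

Lemma psdmxZ n (t : C) (A : 'M[C]_n) : 0 <= t -> psdmx A -> psdmx (t *: A).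
Proof.
by move=> t0 A0 x; rewrite -/(mxform _ x x) mxformZ; exact: mulr_ge0 t0 (A0 x).
Qed.

Lemma psdmx0 n : psdmx (0 : 'M[C]_n).
Proof. by move=> x; rewrite mulmx0 mul0mx mxE. Qed.

Lemma psdmx1 n : psdmx (1%:M : 'M[C]_n).
Proof. by move=> x; rewrite -/(mxform _ x x) mxform1 ler0c hsnorm2_ge0. Qed.

Lemma psdmx_scalar n (t : R) : 0 <= t -> psdmx (t%:C%:M : 'M[C]_n).
Proof.
by move=> t0; rewrite -scalemx1; apply: (psdmxZ _ (@psdmx1 n)); rewrite ler0c.
Qed.

(** Since a form is bounded by the operator norm, a large multiple of the
    identity dominates any self-adjoint matrix. *)
Lemma psdmx_order_unit n (A : 'M[C]_n) :
  exists2 t : R, 0 < t & psdmx (t%:C *: 1%:M + (A + A^t*)).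
Proof.
pose K := opnorm A; have K0 : 0 <= K := opnorm_ge0 A.
exists (2 * K + 1) => [|x]; first by lra.
have AK y : 2 * Re (mxform A y x) <= K * (hsnorm2 y + hsnorm2 x).
  exact: (opnorm_formP A K0).1 (lexx _) y x.
have := AK (- x); rewrite -scaleN1r mxformZl hsnorm2Z rmorphN1 mulN1r ReN.
rewrite normcN Normc.normc1 expr1n mul1r => Ax.
rewrite -/(mxform _ x x) mxformD mxformZ mxform1 mxformD mxform_adj conjC_conjc addcJ.
have -> : 2%:R = (2%:R : R)%:C :> C by rewrite rmorph_nat.
rewrite -!rmorphM -rmorphD ler0c.
by have := hsnorm2_ge0 x; rewrite mulrDl mul1r; lra.
Qed.

End PositiveMatrices.

(** * Separation from a convex cone *)

Section ConeSeparation.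
Context {R : realType} {X : lmodType R[i]}.
Local Notation C := R[i].
Local Notation Re := (@complex.Re R).
Implicit Types (Q T : set X) (u x y z : X).

Definition is_cone Q :=
  [/\ Q 0, forall x y, Q x -> Q y -> Q (x + y) &
    forall (t : R) x, 0 <= t -> Q x -> Q (t%:C *: x)].

(** A maximal cone avoiding [z] is a half-space: if it missed both [x] and [- x],
    then [z] would lie in both cones obtained by adding one of them, and
    a positive combination of the two expressions eliminates [x]. *)
Lemma cone_maximal Q z : is_cone Q -> ~ Q z ->
  exists T, [/\ is_cone T, Q `<=` T, ~ T z & forall x, T x \/ T (- x)].
Proof.
move=> [Q0 QD QZ] Qz.
pose P (B : set X) := is_cone (Q `|` B) /\ ~ (Q `|` B) z.
have [|B [[[T0 TD TZ] Tz] Bmax]] := @Zorn_bigcup _ P.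
  move=> F FP Ftot; split; last first.
    by case=> // -[B FB Bz]; case: (FP _ FB) => _; apply; right.
  have lift B : F B -> Q `|` B `<=` Q `|` \bigcup_(B in F) B.
    by move=> FB w [|Bw]; [left|right; exists B].
  have addF B x y : F B -> (Q `|` B) x -> (Q `|` B) y ->
      (Q `|` \bigcup_(B in F) B) (x + y).
    by move=> FB Bx By; have [[_ BD _] _] := FP _ FB; apply: (lift _ FB); apply: BD.
  split=> [|x y|t x t0]; first by left.
    move=> [Qx|[B FB Bx]] [Qy|[B' FB' By]].
    - by left; apply: QD.
    - by apply: (addF _ _ _ FB'); [left|right].
    - by apply: (addF _ _ _ FB); [right|left].
    - have [BB'|B'B] := Ftot _ _ FB FB'.
        by apply: (addF _ _ _ FB'); right => //; apply: BB'.
      by apply: (addF _ _ _ FB); right => //; apply: B'B.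
  move=> [Qx|[B FB Bx]]; first by left; apply: QZ.
  have [[_ _ BZ] _] := FP _ FB; by apply: (lift _ FB); apply: BZ => //; right.
set T := Q `|` B in T0 TD TZ Tz.
exists T; split=> // [x Qx|x]; first by left.
have extP y : ~ T y -> exists q (s : R), [/\ T q, 0 <= s & z = q + s%:C *: y].
  move=> Ty; apply: contrapT => nz.
  pose E := [set w | exists q (s : R), [/\ T q, 0 <= s & w = q + s%:C *: y]].
  have TE : T `<=` E.
    by move=> w Tw; exists w, 0; split=> //; rewrite scale0r addr0.
  have QE : Q `|` E = E.
    by apply/seteqP; split=> [w [Qw|]|w]; [apply: TE; left| |right].
  apply: (Bmax E); last first.
    rewrite /P QE; split=> //; split=> [|_ _ [q [s [Tq s0 ->]]] [q' [s' [Tq' s0' ->]]]|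
      t _ t0 [q [s [Tq s0 ->]]]].
    - exact: TE.
    - exists (q + q'), (s + s'); split; [exact: TD|exact: addr_ge0|].
      by rewrite rmorphD scalerDl addrACA.
    - exists (t%:C *: q), (t * s); split; [exact: TZ|exact: mulr_ge0|].
      by rewrite scalerDr scalerA rmorphM.
  split=> [w Bw|EB]; first by apply: TE; right.
  apply: Ty; right; apply: EB; exists 0, 1; split=> //.
  by rewrite scale1r add0r.
apply: contrapT => /not_orP[/extP[q [s [Tq s0 zq]]] /extP[q' [s' [Tq' s0' zq']]]].
have [s_0|sn0] := eqVneq s 0.
  by apply: Tz; rewrite zq s_0 scale0r addr0.
have sp : 0 < s + s' by rewrite ltr_wpDr // lt_neqAle eq_sym sn0.
apply: Tz.
have -> : z = (s + s')^-1%:C *: (s'%:C *: q + s%:C *: q').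
  apply: (@scalerI _ _ (s + s')%:C).
    by rewrite fmorph_eq0 gt_eqF.
  rewrite scalerA -rmorphM mulfV ?gt_eqF // scale1r rmorphD scalerDl.
  rewrite {1}zq' zq !scalerDr !scalerA scalerN -!rmorphM [s' * s]mulrC.
  by rewrite addrACA addNr addr0 addrC.
apply: (TZ); first by rewrite invr_ge0 ltW.
by apply: TD; apply: TZ.
Qed.

(** Krein's extension theorem in separation form. A cone with an order unit
    which misses [z] is contained in a half-space that misses [z]; the order
    unit turns that half-space into a linear functional
    [g x = inf {t | t u - x in T}]. It is first only real linear, and
    [x |-> g x - i g (i x)] is its complex linear counterpart. *)
Lemma cone_separation Q u z : is_cone Q ->
    (forall x, exists2 t : R, 0 < t & Q (t%:C *: u + x)) -> ~ Q z ->
  exists G : X -> C, [/\ forall (c : C) x y, G (c *: x + y) = c * G x + G y,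
    forall x, Q x -> 0 <= Re (G x), Re (G u) = 1 & Re (G z) <= 0].
Proof.
move=> Qcone Qunit Qz.
have [T [[T0 TD TZ] QT Tz Ttot]] := cone_maximal Qcone Qz.
have Tunit x : exists2 t : R, 0 < t & T (t%:C *: u + x).
  by have [t t0 Qt] := Qunit x; exists t => //; apply: QT.
have Tu (s : R) : 0 <= s <-> T (s%:C *: u).
  have Tu1 : T u.
    have [t t0] := Tunit 0; rewrite addr0 => /(TZ t^-1 _ _).
    by rewrite scalerA -rmorphM mulVf ?gt_eqF // scale1r invr_ge0 ltW //; apply.
  split=> [s0|Ts]; first exact: TZ.
  rewrite leNgt; apply/negP => s0; apply: Tz.
  have [t t0 Tt] := Tunit z.
  have -> : z = (t%:C *: u + z) + (t * - s^-1)%:C *: (s%:C *: u).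
    rewrite scalerA -rmorphM -mulrA mulNr mulVf ?lt_eqF // mulrN1 rmorphN.
    by rewrite scaleNr addrAC subrr add0r.
  apply: TD => //; apply: TZ => //.
  by rewrite mulr_ge0 ?ltW // -invrN invr_gt0 oppr_gt0.
(* [T] is a half-space, so [S x] is a ray and [g x] its endpoint. *)
pose S x := [set t : R | T (t%:C *: u - x)].
have Slb x : exists s, forall t, S x t -> - s <= t.
  have [s _ Ts] := Tunit x; exists s => t St.
  rewrite -subr_ge0 opprK; apply/Tu; rewrite rmorphD scalerDl.
  by have := TD _ _ St Ts; rewrite addrACA addNr addr0.
have Sinf x : has_inf (S x).
  split; first by have [t _ Tt] := Tunit (- x); exists t.
  by have [s sS] := Slb x; exists (- s).
pose g x := inf (S x).
have g_le x t : S x t -> g x <= t by apply: ge_inf; case: (Sinf x).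
have gT x t : g x < t -> T (t%:C *: u - x).
  move=> gt; have e0 : 0 < t - g x by rewrite subr_gt0.
  have [s Ss] := inf_adherent e0 (Sinf x); rewrite -/(g x) addrC subrK => st.
  have -> : t%:C *: u - x = (t - s)%:C *: u + (s%:C *: u - x).
    by rewrite rmorphB scalerBl addrA subrK.
  by apply: TD => //; apply/Tu; rewrite subr_ge0 ltW.
have Tg x t : t < g x -> T (x - t%:C *: u).
  move=> tg; case: (Ttot (x - t%:C *: u)) => //; rewrite opprB => /g_le.
  by rewrite leNgt tg.
have gle x t : (forall s, t < s -> T (s%:C *: u - x)) -> g x <= t.
  by move=> H; apply/unstable.ler_gtP => s /H/g_le.
have gge x t : (forall s, s < t -> T (x - s%:C *: u)) -> t <= g x.
  move=> H; apply/unstable.ler_ltP => s /H Ts; apply: lb_le_inf; first exact: (Sinf x).1.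
  move=> r Sr; rewrite -subr_ge0; apply/Tu; rewrite rmorphB scalerBl.
  by have := TD _ _ Ts Sr; rewrite addrC addrA subrK.
have gD x y : g (x + y) = g x + g y.
  apply/eqP; rewrite eq_le; apply/andP; split.
    apply: gle => s; rewrite -ltrBrDl => lts.
    pose e := (s - g y - g x) / 2.
    have e0 : 0 < e by rewrite divr_gt0 // subr_gt0 ltrBrDl addrC -ltrBrDl.
    have -> : s%:C *: u - (x + y) =
        ((g x + e)%:C *: u - x) + ((g y + e)%:C *: u - y).
      rewrite addrACA -scalerDl -rmorphD opprD; congr (_%:C *: u + _).
      by rewrite /e; field.
    by apply: TD; apply: gT; rewrite ltrDl.
  apply: gge => s lts; pose e := (g y + g x - s) / 2.
  have e0 : 0 < e by rewrite divr_gt0 // subr_gt0 addrC.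
  have -> : x + y - s%:C *: u =
      (x - (g x - e)%:C *: u) + (y - (g y - e)%:C *: u).
    rewrite addrACA -opprD -scalerDl -rmorphD; congr (_ - _%:C *: u).
    by rewrite /e; field.
  by apply: TD; apply: Tg; rewrite ltrBlDr ltrDl.
have g0 : g 0 = 0 by apply: (addrI (g 0)); rewrite -gD !addr0.
have gN x : g (- x) = - g x.
  by apply/eqP; rewrite -addr_eq0 -gD addNr g0.
have gZp (t : R) x : 0 < t -> g (t%:C *: x) = t * g x.
  have half (s : R) y : 0 < s -> g (s%:C *: y) <= s * g y.
    move=> s0; rewrite -ler_pdivrMl //; apply/unstable.ler_gtP => r.
    move=> /gT/(TZ s _ (ltW s0)); rewrite scalerBr scalerA -rmorphM => /g_le.
    by rewrite -ler_pdivrMl.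
  move=> t0; apply/eqP; rewrite eq_le half //= -ler_pdivlMl //.
  have := half t^-1 (t%:C *: x).
  by rewrite scalerA -rmorphM mulVf ?gt_eqF // scale1r invr_gt0; apply.
have gZ (t : R) x : g (t%:C *: x) = t * g x.
  have [t0|t0|->] := ltgtP t 0; last by rewrite scale0r mul0r.
    by apply: oppr_inj; rewrite -gN -scaleNr -rmorphN gZp ?oppr_gt0 // mulNr.
  exact: gZp.
have gQ x : Q x -> 0 <= g x.
  move=> /QT Tx; rewrite -oppr_le0 -gN; apply: g_le.
  by rewrite /S /= scale0r add0r opprK.
pose j : C := 'i%C.
have gC (a b : R) x : g ((a +i* b) *: x) = a * g x + b * g (j *: x).
  have -> : a +i* b = a%:C + b%:C * j.
    by apply/eqP; rewrite eq_complex /= !mul0r !mulr0 mulr1 subrr !addr0 add0r !eqxx.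
  by rewrite scalerDl gD gZ -scalerA gZ.
have ReG x : Re ((g x)%:C - j * (g (j *: x))%:C) = g x.
  by rewrite /= mul0r mul1r sub0r !oppr0 addr0.
exists (fun x => (g x)%:C - j * (g (j *: x))%:C); split=> [c x y|x Qx||].
- case: c => a b; rewrite scalerDr !gD scalerA.
  have -> : j * (a +i* b) = (- b) +i* a.
    by apply/eqP; rewrite eq_complex /= !mul0r !mul1r sub0r add0r !eqxx.
  rewrite !(gC a) !(gC (- b)).
  move: (g x) (g (j *: x)) (g y) (g (j *: y)) => p q r s.
  apply/eqP; rewrite eq_complex /=.
  by apply/andP; split; apply/eqP; ring.
- by rewrite ReG gQ.
- rewrite ReG; apply/eqP; rewrite eq_le; apply/andP; split.
    by apply: g_le; rewrite /S /= scale1r subrr.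
  apply: gge => s s1; rewrite -{1}[u]scale1r -scalerBl -(rmorph1 (real_complex R)).
  by rewrite -rmorphB; apply/Tu; rewrite subr_ge0 ltW.
- rewrite ReG; apply: g_le; rewrite /S /= scale0r add0r.
  by case: (Ttot z).
Qed.

End ConeSeparation.

(** * Matrices over a vector space *)

Section Sandwich.
Context {R : realType} {V : lmodType R[i]}.
Local Notation C := R[i].

Definition sandwich m n p q (A : 'M[C]_(m, n)) (v : 'M[V]_(n, p))
  (B : 'M[C]_(p, q)) : 'M[V]_(m, q) := rmulsmx (lmulsmx A v) B.

Lemma sandwichE m n p q (A : 'M[C]_(m, n)) (v : 'M[V]_(n, p))
    (B : 'M[C]_(p, q)) i j :
  sandwich A v B i j = \sum_l \sum_k (A i k * B l j) *: v k l.
Proof.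
rewrite mxE; apply: eq_bigr => l _; rewrite mxE scaler_sumr.
by apply: eq_bigr => k _; rewrite scalerA mulrC.
Qed.

Lemma sandwich_comp m n p q r s (A : 'M[C]_(m, n)) (A' : 'M[C]_(n, p))
    (v : 'M[V]_(p, q)) (B' : 'M[C]_(q, r)) (B : 'M[C]_(r, s)) :
  sandwich A (sandwich A' v B') B = sandwich (A *m A') v (B' *m B).
Proof.
have lmA (w : 'M[V]_(p, q)) : lmulsmx A (lmulsmx A' w) = lmulsmx (A *m A') w.
  apply/matrixP => i j; rewrite !mxE.
  under eq_bigr do rewrite mxE scaler_sumr.
  rewrite exchange_big; apply: eq_bigr => k _; rewrite mxE scaler_suml.
  by apply: eq_bigr => l _; rewrite scalerA.
have rmA (w : 'M[V]_(m, q)) : rmulsmx (rmulsmx w B') B = rmulsmx w (B' *m B).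
  apply/matrixP => i j; rewrite !mxE.
  under eq_bigr do rewrite mxE scaler_sumr.
  rewrite exchange_big; apply: eq_bigr => k _; rewrite mxE scaler_suml.
  by apply: eq_bigr => l _; rewrite scalerA mulrC.
have lmrm a b c d (A0 : 'M[C]_(a, b)) (w : 'M[V]_(b, c)) (B0 : 'M[C]_(c, d)) :
    lmulsmx A0 (rmulsmx w B0) = rmulsmx (lmulsmx A0 w) B0.
  apply/matrixP => i j; rewrite !mxE.
  under eq_bigr do rewrite mxE scaler_sumr.
  rewrite exchange_big; apply: eq_bigr => k _; rewrite mxE scaler_sumr.
  by apply: eq_bigr => l _; rewrite !scalerA mulrC.
by rewrite /sandwich lmrm rmA lmA.
Qed.

Lemma sandwich1 m n (v : 'M[V]_(m, n)) : sandwich 1%:M v 1%:M = v.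
Proof.
apply/matrixP => i j; rewrite sandwichE (bigD1 j) //= (bigD1 i) //=.
rewrite !mxE !eqxx mulr1 scale1r big1 ?addr0 => [|k ki]; last first.
  by rewrite mxE eq_sym (negbTE ki) mul0r scale0r.
rewrite big1 ?addr0 // => l lj; rewrite big1 // => k _.
by rewrite [X in _ * X]mxE (negbTE lj) mulr0 scale0r.
Qed.

Lemma sandwichD m n p q (A : 'M[C]_(m, n)) (v w : 'M[V]_(n, p))
    (B : 'M[C]_(p, q)) :
  sandwich A (v + w) B = sandwich A v B + sandwich A w B.
Proof.
apply/matrixP => i j; rewrite [RHS]mxE !sandwichE -big_split; apply: eq_bigr => l _.
by rewrite -big_split; apply: eq_bigr => k _; rewrite mxE scalerDr.
Qed.

Lemma sandwichZ m n p q c (A : 'M[C]_(m, n)) (v : 'M[V]_(n, p))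
    (B : 'M[C]_(p, q)) :
  sandwich A (scalesmx c v) B = scalesmx c (sandwich A v B).
Proof.
apply/matrixP => i j; rewrite [RHS]mxE !sandwichE scaler_sumr.
apply: eq_bigr => l _; rewrite scaler_sumr; apply: eq_bigr => k _.
by rewrite mxE !scalerA mulrC.
Qed.

Lemma sandwichDl m n p q (A A' : 'M[C]_(m, n)) (v : 'M[V]_(n, p))
    (B : 'M[C]_(p, q)) :
  sandwich (A + A') v B = sandwich A v B + sandwich A' v B.
Proof.
apply/matrixP => i j; rewrite [RHS]mxE !sandwichE -big_split; apply: eq_bigr => l _.
rewrite -big_split; apply: eq_bigr => k _.
by rewrite mxE mulrDl scalerDl.
Qed.

Lemma sandwichDr m n p q (A : 'M[C]_(m, n)) (v : 'M[V]_(n, p))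
    (B B' : 'M[C]_(p, q)) :
  sandwich A v (B + B') = sandwich A v B + sandwich A v B'.
Proof.
apply/matrixP => i j; rewrite [RHS]mxE !sandwichE -big_split; apply: eq_bigr => l _.
rewrite -big_split; apply: eq_bigr => k _.
by rewrite mxE mulrDr scalerDl.
Qed.

Lemma sandwichZl m n p q c (A : 'M[C]_(m, n)) (v : 'M[V]_(n, p))
    (B : 'M[C]_(p, q)) :
  sandwich (c *: A) v B = scalesmx c (sandwich A v B).
Proof.
apply/matrixP => i j; rewrite [RHS]mxE !sandwichE scaler_sumr; apply: eq_bigr => l _.
rewrite scaler_sumr; apply: eq_bigr => k _.
by rewrite mxE scalerA mulrA.
Qed.

Lemma sandwichZr m n p q c (A : 'M[C]_(m, n)) (v : 'M[V]_(n, p))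
    (B : 'M[C]_(p, q)) :
  sandwich A v (c *: B) = scalesmx c (sandwich A v B).
Proof.
apply/matrixP => i j; rewrite [RHS]mxE !sandwichE scaler_sumr; apply: eq_bigr => l _.
rewrite scaler_sumr; apply: eq_bigr => k _.
by rewrite mxE scalerA mulrCA.
Qed.

Lemma scalesmxA m n c d (v : 'M[V]_(m, n)) :
  scalesmx c (scalesmx d v) = scalesmx (c * d) v.
Proof. by apply/matrixP => i j; rewrite !mxE scalerA. Qed.

Lemma scale1smx m n (v : 'M[V]_(m, n)) : scalesmx 1 v = v.
Proof. by apply/matrixP => i j; rewrite !mxE scale1r. Qed.

Lemma scalesmxDr m n c (v w : 'M[V]_(m, n)) :
  scalesmx c (v + w) = scalesmx c v + scalesmx c w.
Proof. by apply/matrixP => i j; rewrite !mxE scalerDr. Qed.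

Lemma scalesmxDl m n (v : 'M[V]_(m, n)) c d :
  scalesmx (c + d) v = scalesmx c v + scalesmx d v.
Proof. by apply/matrixP => i j; rewrite !mxE scalerDl. Qed.

Lemma scaleN1smx m n (v : 'M[V]_(m, n)) : scalesmx (-1) v = - v.
Proof. by apply/matrixP => i j; rewrite !mxE scaleN1r. Qed.

Lemma scale0smx m n (v : 'M[V]_(m, n)) : scalesmx 0 v = 0.
Proof. by apply/matrixP => i j; rewrite !mxE scale0r. Qed.

Lemma sandwichN m n p q (A : 'M[C]_(m, n)) (v : 'M[V]_(n, p))
    (B : 'M[C]_(p, q)) : sandwich A (- v) B = - sandwich A v B.
Proof. by rewrite -scaleN1smx sandwichZ scaleN1smx. Qed.

Lemma sandwich0 m n p q (A : 'M[C]_(m, n)) (B : 'M[C]_(p, q)) :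
  sandwich A (0 : 'M[V]_(n, p)) B = 0.
Proof. by rewrite -(scale0smx 0) sandwichZ scale0smx. Qed.

Lemma sandwich0l m n p q (v : 'M[V]_(n, p)) (B : 'M[C]_(p, q)) :
  sandwich (0 : 'M[C]_(m, n)) v B = 0.
Proof. by rewrite -(scale0r 0) sandwichZl scale0smx. Qed.

Lemma sandwich0r m n p q (A : 'M[C]_(m, n)) (v : 'M[V]_(n, p)) :
  sandwich A v (0 : 'M[C]_(p, q)) = 0.
Proof. by rewrite -(scale0r 0) sandwichZr scale0smx. Qed.

Lemma sandwich_block m n1 n2 p1 p2 q
    (A1 : 'M[C]_(m, n1)) (A2 : 'M[C]_(m, n2))
    (a : 'M[V]_(n1, p1)) (b : 'M[V]_(n1, p2))
    (c : 'M[V]_(n2, p1)) (d : 'M[V]_(n2, p2))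
    (B1 : 'M[C]_(p1, q)) (B2 : 'M[C]_(p2, q)) :
  sandwich (row_mx A1 A2) (block_mx a b c d) (col_mx B1 B2) =
  sandwich A1 a B1 + sandwich A2 c B1 + (sandwich A1 b B2 + sandwich A2 d B2).
Proof.
apply/matrixP => i j; rewrite sandwichE big_split_ord [RHS]mxE.
rewrite [X in _ = X + _]mxE [X in _ = _ + X]mxE !sandwichE.
rewrite -!big_split; congr (_ + _); apply: eq_bigr => l _.
  rewrite big_split_ord; congr (_ + _); apply: eq_bigr => k _.
    by rewrite row_mxEl col_mxEu block_mxEul.
  by rewrite row_mxEr col_mxEu block_mxEdl.
rewrite big_split_ord; congr (_ + _); apply: eq_bigr => k _.
  by rewrite row_mxEl col_mxEd block_mxEur.
by rewrite row_mxEr col_mxEd block_mxEdr.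
Qed.

(** The elementary tensor of [M] and [e], when matrices over [V] are seen as the
    tensor product of scalar matrices with [V]. *)
Definition ampmx (e : V) m n (M : 'M[C]_(m, n)) : 'M[V]_(m, n) :=
  map_mx (fun c => c *: e) M.

Lemma sandwich_amp e m n p q (A : 'M[C]_(m, n)) (M : 'M[C]_(n, p))
    (B : 'M[C]_(p, q)) : sandwich A (ampmx e M) B = ampmx e (A *m M *m B).
Proof.
apply/matrixP => i j; rewrite sandwichE !mxE scaler_suml; apply: eq_bigr => l _.
rewrite mxE mulr_suml scaler_suml; apply: eq_bigr => k _.
by rewrite mxE scalerA mulrAC.
Qed.

Lemma ampmxD e m n (M M' : 'M[C]_(m, n)) :
  ampmx e (M + M') = ampmx e M + ampmx e M'.
Proof. by apply/matrixP => i j; rewrite !mxE scalerDl. Qed.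

Lemma ampmxZ e m n c (M : 'M[C]_(m, n)) :
  ampmx e (c *: M) = scalesmx c (ampmx e M).
Proof. by apply/matrixP => i j; rewrite !mxE scalerA. Qed.

Lemma scalar_ampmx e n (c : C) : (c *: e)%:M = ampmx e (c%:M : 'M_n).
Proof.
by apply/matrixP => i j; rewrite !mxE; case: eqP; rewrite ?mulr1n ?mulr0n ?scale0r.
Qed.

End Sandwich.

Section StarMatrices.
Context {R : realType} {V : lmodType R[i]} (star : V -> V).
Hypothesis star_inv : is_involution star.
Local Notation C := R[i].

Lemma starvD u v : star (u + v) = star u + star v.
Proof. by have := star_inv.2 1 u v; rewrite rmorph1 !scale1r. Qed.

Lemma starv0 : star 0 = 0.
Proof. by apply: (addrI (star 0)); rewrite -starvD !addr0. Qed.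

Lemma starvZ c v : star (c *: v) = c^*%R *: star v.
Proof. by have := star_inv.2 c v 0; rewrite !addr0 starv0 addr0. Qed.

Lemma starv_sum (I : Type) (r : seq I) (F : I -> V) :
  star (\sum_(i <- r) F i) = \sum_(i <- r) star (F i).
Proof. exact: (big_morph star starvD starv0). Qed.

Lemma starmxD m n (v w : 'M[V]_(m, n)) :
  starmx star (v + w) = starmx star v + starmx star w.
Proof. by apply/matrixP => i j; rewrite !mxE starvD. Qed.

Lemma starmxZ m n c (v : 'M[V]_(m, n)) :
  starmx star (scalesmx c v) = scalesmx c^*%R (starmx star v).
Proof. by apply/matrixP => i j; rewrite !mxE starvZ. Qed.

Lemma starmxN m n (v : 'M[V]_(m, n)) : starmx star (- v) = - starmx star v.
Proof. by rewrite -!scaleN1smx starmxZ rmorphN1. Qed.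

Lemma starmx0 m n : starmx star (0 : 'M[V]_(m, n)) = 0.
Proof. by rewrite -(scale0smx 0) starmxZ rmorph0 scale0smx. Qed.

Lemma starmx_sandwich m n p q (A : 'M[C]_(m, n)) (v : 'M[V]_(n, p))
    (B : 'M[C]_(p, q)) :
  starmx star (sandwich A v B) = sandwich (B^t*) (starmx star v) (A^t*).
Proof.
apply/matrixP => i j; rewrite 2!mxE !sandwichE starv_sum [RHS]exchange_big.
apply: eq_bigr => l _; rewrite starv_sum; apply: eq_bigr => k _.
by rewrite starvZ !mxE rmorphM mulrC.
Qed.

Lemma starmx_amp e m n (M : 'M[C]_(m, n)) : star e = e ->
  starmx star (ampmx e M) = ampmx e (M^t*).
Proof. by move=> se; apply/matrixP => i j; rewrite !mxE starvZ se. Qed.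

End StarMatrices.

(** An alias that carries the action of the scalars of [V], as opposed to the
    action on a matrix of the ring of its coefficients. *)
Definition vmx (R : realType) (V : lmodType R[i]) m n := 'M[V]_(m, n).

HB.instance Definition _ (R : realType) (V : lmodType R[i]) m n :=
  GRing.Zmodule.on (vmx V m n).
HB.instance Definition _ (R : realType) (V : lmodType R[i]) m n :=
  GRing.Zmodule_isLmodule.Build R[i] (vmx V m n)
    (@scalesmxA R V m n) (@scale1smx R V m n) (@scalesmxDr R V m n)
    (@scalesmxDl R V m n).

(** * The matrix pairing and the order unit of matrices *)

Section Pairing.
Context {R : realType} {V : matrixOrderUnitSpace R}.
Local Notation C := R[i].
Local Notation Re := (@complex.Re R).

Definition unvec n r (x : 'cV[C]_(n * r)) : 'M[C]_(n, r) :=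
  \matrix_(i, k) x (mxtens_index (i, k)) 0.

Lemma sum_mxtens_index (U : nmodType) n r (F : 'I_(n * r) -> U) :
  \sum_p F p = \sum_i \sum_k F (mxtens_index (i, k)).
Proof.
rewrite pair_bigA (reindex (@mxtens_index n r)) /=.
  by apply: eq_bigr => -[i k].
by apply: onW_bij; exists (@mxtens_unindex n r);
  [exact: mxtens_indexK|exact: mxtens_unindexK].
Qed.

Lemma unvec_surj n r (X : 'M[C]_(n, r)) : exists x, unvec x = X.
Proof.
exists (\col_p X (mxtens_unindex p).1 (mxtens_unindex p).2).
by apply/matrixP => i k; rewrite !mxE mxtens_indexK.
Qed.

Lemma hsnorm2_unvec n r (x : 'cV[C]_(n * r)) : hsnorm2 (unvec x) = hsnorm2 x.
Proof.
rewrite /hsnorm2 [RHS]sum_mxtens_index; apply: eq_bigr => i _.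
by apply: eq_bigr => k _; rewrite big_ord1 mxE.
Qed.

(** A linear map [V -> M_r] is the same thing as a linear functional on
    [M_r(V)], namely this one. *)
Definition functional_of r (f : V -> 'M[C]_r) (x : 'M[V]_r) : C :=
  \sum_k \sum_l f (x k l) k l.

Lemma functional_ofD r (f : {linear V -> 'M[C]_r}) x y :
  functional_of f (x + y) = functional_of f x + functional_of f y.
Proof.
rewrite /functional_of -big_split; apply: eq_bigr => k _.
by rewrite -big_split; apply: eq_bigr => l _; rewrite mxE linearD mxE.
Qed.

Lemma functional_ofZ r (f : {linear V -> 'M[C]_r}) c x :
  functional_of f (scalesmx c x) = c * functional_of f x.
Proof.
rewrite /functional_of mulr_sumr; apply: eq_bigr => k _.
by rewrite mulr_sumr; apply: eq_bigr => l _; rewrite mxE linearZ mxE.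
Qed.

(** A vector indexed by pairs is a rectangular matrix; read in this way, the
    two sides are the same quadruple sum. Through this formula, positivity and
    norm bounds for the pairing become statements on one scalar functional. *)
Lemma pairing_form n r (f : {linear V -> 'M[C]_r}) (a : 'M[V]_n) x y :
  (x^t* *m mx_pairing f a *m y) 0 0 =
  functional_of f (sandwich ((unvec x)^t*) a (unvec y)).
Proof.
rewrite mxE sum_mxtens_index exchange_big /=.
under eq_bigr => l _ do under eq_bigr => j _ do
  rewrite mxE sum_mxtens_index exchange_big /= mulr_suml.
rewrite /functional_of [RHS]exchange_big /=; apply: eq_bigr => l _.
rewrite exchange_big; apply: eq_bigr => k _ /=.
rewrite sandwichE linear_sum summxE; apply: eq_bigr => j _.
rewrite linear_sum summxE mulr_suml; apply: eq_bigr => i _.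
by rewrite linearZ !mxE !mxtens_indexK /= mulrAC.
Qed.

Lemma opnorm_pairingP n r (f : {linear V -> 'M[C]_r}) (a : 'M[V]_n) K :
  0 <= K -> opnorm (mx_pairing f a) <= K <-> forall X Y : 'M[C]_(n, r),
    2 * Re (functional_of f (sandwich (X^t*) a Y)) <= K * (hsnorm2 X + hsnorm2 Y).
Proof.
move=> K0; split=> [/opnorm_formP fK X Y|fK].
  have [x <-] := unvec_surj X; have [y <-] := unvec_surj Y.
  by rewrite -pairing_form !hsnorm2_unvec; apply: fK.
by apply/opnorm_formP => // x y; rewrite pairing_form -!hsnorm2_unvec.
Qed.

Lemma psdmx_pairingP n r (f : {linear V -> 'M[C]_r}) (a : 'M[V]_n) :
  psdmx (mx_pairing f a) <-> forall X : 'M[C]_(n, r),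
    0 <= functional_of f (sandwich (X^t*) a X).
Proof.
split=> [f0 X|f0 x]; last by rewrite pairing_form.
by have [x <-] := unvec_surj X; rewrite -pairing_form.
Qed.

Lemma mx_pairingB n r (f g : {linear V -> 'M[C]_r}) (a : 'M[V]_n) :
  mx_pairing f a - mx_pairing g a = mx_pairing (f \- g) a.
Proof. by apply/matrixP => i j; rewrite !mxE. Qed.

Lemma functional_ofB r (f g : {linear V -> 'M[C]_r}) x :
  functional_of (f \- g) x = functional_of f x - functional_of g x.
Proof.
rewrite /functional_of -sumrB; apply: eq_bigr => k _.
by rewrite -sumrB; apply: eq_bigr => l _; rewrite !mxE.
Qed.

Lemma ex_linear r (f : V -> 'M[C]_r) :
  (forall c u v, f (c *: u + v) = c *: f u + f v) ->
  exists g : {linear V -> 'M[C]_r}, g = f :> (V -> 'M[C]_r).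
Proof.
move=> flin; pose m := GRing.isLinear.Build C V 'M[C]_r *:%R f flin.
by exists (HB.pack_for {linear V -> 'M[C]_r} f m).
Qed.

Lemma sandwich_delta r (x : 'M[V]_r) :
  x = \sum_k \sum_l sandwich (delta_mx k 0 : 'cV[C]_r) ((x k l)%:M : 'M_1)
        (delta_mx 0 l : 'rV[C]_r).
Proof.
apply/matrixP => i j; rewrite summxE (bigD1 i) //= summxE (bigD1 j) //=.
have E k l : sandwich (delta_mx k 0 : 'cV[C]_r) ((x k l)%:M : 'M_1)
        (delta_mx 0 l : 'rV[C]_r) i j = ((i == k) && (j == l))%:R *: x k l.
  rewrite sandwichE !big_ord1 !mxE !eqxx mulr1n andbT /=.
  by rewrite -natrM mulnb.
rewrite E !eqxx scale1r big1 => [|l lj]; last first.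
  by rewrite E [j == l]eq_sym (negbTE lj) andbF scale0r.
rewrite big1 ?addr0 // => k ki; rewrite summxE big1 // => l _.
by rewrite E [i == k]eq_sym (negbTE ki) scale0r.
Qed.

Lemma functional_of_surj r (F : 'M[V]_r -> C) :
  (forall c x y, F (scalesmx c x + y) = c * F x + F y) ->
  exists f : {linear V -> 'M[C]_r}, forall x, functional_of f x = F x.
Proof.
move=> Flin; pose E (k l : 'I_r) (v : V) := sandwich (delta_mx k 0 : 'cV[C]_r) (v%:M : 'M_1)
  (delta_mx 0 l : 'rV[C]_r).
have [|f fE] := @ex_linear r (fun v => \matrix_(k, l) F (E k l v)).
  move=> c u v; apply/matrixP => k l; rewrite !mxE -Flin; congr F.
  rewrite -sandwichZ -sandwichD; congr sandwich; apply/matrixP => i j.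
  by rewrite !ord1 !mxE !eqxx !mulr1n.
have FD x y : F (x + y) = F x + F y.
  by have := Flin 1 x y; rewrite scale1smx mul1r.
have F0 : F 0 = 0 by apply: (addrI (F 0)); rewrite -FD !addr0.
exists f => x; rewrite [in RHS](sandwich_delta x) (big_morph F FD F0).
rewrite fE; apply: eq_bigr => k _; rewrite (big_morph F FD F0).
by apply: eq_bigr => l _; rewrite mxE.
Qed.

End Pairing.

Section OrderUnit.
Context {R : realType} {V : matrixOrderUnitSpace R}.
Local Notation C := R[i].
Local Notation Re := (@complex.Re R).
Local Notation Im := (@complex.Im R).
Local Notation star := (@mou_star R V).
Local Notation pos := (@mou_pos R V _).
Local Notation e := (@mou_unit R V).

Lemma mou_starP : is_involution star.
Proof. exact: (mo_star (mou_matrix_ordered V)). Qed.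

Lemma pos_sandwich m n (ga : 'M[C]_(n, m)) (v : 'M[V]_n) :
  (0 < m)%N -> (0 < n)%N -> pos v -> pos (sandwich (ga^t*) v ga).
Proof. move=> m0 n0; exact: (mo_conj (mou_matrix_ordered V)). Qed.

Lemma posD n (v w : 'M[V]_n) : (0 < n)%N -> pos v -> pos w -> pos (v + w).
Proof. by move=> n0; exact: (coneD (mo_cone (mou_matrix_ordered V) n0)). Qed.

Lemma posZ n (t : R) (v : 'M[V]_n) :
  (0 < n)%N -> 0 <= t -> pos v -> pos (scalesmx t%:C v).
Proof. by move=> n0; exact: (coneZ (mo_cone (mou_matrix_ordered V) n0)). Qed.

Lemma pos0 n : (0 < n)%N -> pos (0 : 'M[V]_n).
Proof. by move=> n0; exact: (cone0 (mo_cone (mou_matrix_ordered V) n0)). Qed.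

Lemma pos_self_adjoint n (v : 'M[V]_n) :
  (0 < n)%N -> pos v -> starmx star v = v.
Proof.
by move=> n0; exact: (cone_selfadjoint (mo_cone (mou_matrix_ordered V) n0)).
Qed.

(** For a Gram matrix this is a sum of compressions of the unit by rows. *)
Lemma pos_amp n (B : 'M[C]_n) : (0 < n)%N -> psdmx B -> pos (ampmx e B).
Proof.
move=> n0 /psdmx_factor[T ->].
have e1 : pos (e%:M : 'M[V]_1).
  have [t t0] := (mou_order_unit V).2 0 (starv0 mou_starP); rewrite addr0 => te.
  have := posZ (isT : 0 < 1)%N (_ : 0 <= t^-1) te.
  rewrite invr_ge0 ltW // => /(_ isT); congr (pos _); apply/matrixP => i j.
  by rewrite !ord1 !mxE !mulr1n scalerA -rmorphM mulVf ?gt_eqF // rmorph1 scale1r.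
have -> : ampmx e (T^t* *m T) =
    \sum_i sandwich ((row i T)^t*) (e%:M : 'M[V]_1) (row i T).
  have -> : (e%:M : 'M[V]_1) = ampmx e 1%:M.
    by rewrite -[e in LHS]scale1r scalar_ampmx.
  under eq_bigr do rewrite sandwich_amp mulmx1.
  apply/matrixP => k l; rewrite summxE !mxE scaler_suml; apply: eq_bigr => i _.
  by rewrite !mxE big_ord1 !mxE.
elim/big_ind: _ => [|v w|i _]; [exact: pos0|exact: posD|exact: pos_sandwich].
Qed.

(** The matrix order unit: [t e] dominates every self-adjoint matrix over [V]
    for [t] large. By linearity it suffices to treat [al^* b be] with [b]
    self-adjoint, and there
    [(al + be)^*(t + b)(al + be) + (al - be)^*(t - b)(al - be)] is positive. *)
Lemma matrix_order_unit n (x : 'M[V]_n) : (0 < n)%N ->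
  exists2 t : R, 0 < t & pos (ampmx e (t%:C%:M) + (x + starmx star x)).
Proof.
move=> n0; have sP := mou_starP.
pose S (x : 'M[V]_n) :=
  exists2 t : R, 0 < t & pos (ampmx e (t%:C%:M) + (x + starmx star x)).
have SD y z : S y -> S z -> S (y + z).
  move=> [t t0 yt] [s s0 zs]; exists (t + s); first exact: addr_gt0.
  rewrite rmorphD raddfD ampmxD starmxD // (addrACA y z) (addrACA (ampmx _ _)).
  exact: (posD n0 yt zs).
have Ssa (al be : 'rV[C]_n) (b : V) : star b = b ->
    S (sandwich (al^t*) (b%:M : 'M_1) be).
  move=> bsa; have bsa1 : starmx star (b%:M : 'M_1) = b%:M.
    by apply/matrixP => i j; rewrite !ord1 !mxE eqxx !mulr1n.
  have [t t0 tb] := (mou_order_unit V).2 b bsa.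
  have bN : star (- b) = - b by rewrite -scaleN1r starvZ // rmorphN1 bsa.
  have [s s0 sb] := (mou_order_unit V).2 (- b) bN; set y := sandwich _ _ _.
  pose W := t%:C *: ((al + be)^t* *m (al + be)) +
            s%:C *: ((al - be)^t* *m (al - be)).
  have Wpsd : psdmx W.
    by apply: psdmxD; apply: psdmxZ; rewrite ?ler0c ?ltW //; apply: psdmx_gram.
  have posW : pos (ampmx e W + scalesmx 2 (y + starmx star y)).
    have cut (u : V) (d : 'rV[C]_n) r : sandwich (d^t*) ((r%:C *: e + u)%:M : 'M_1) d =
        ampmx e (r%:C *: (d^t* *m d)) + sandwich (d^t*) (u%:M : 'M_1) d.
      rewrite [_%:M]raddfD sandwichD -[X in sandwich _ X _ + _]/((r%:C *: e)%:M).
      rewrite scalar_ampmx sandwich_amp mul_mx_scalar.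
      by rewrite -scalemxAl.
    have := posD n0 (pos_sandwich (al + be) n0 isT tb)
                    (pos_sandwich (al - be) n0 isT sb).
    rewrite !cut addrACA -ampmxD -/W; congr (pos (_ + _)).
    rewrite (raddfN (@scalar_mx V 1)) sandwichN /y starmx_sandwich // bsa1 trmxCK.
    rewrite !adjmxD -[- be]scaleN1r adjmxZ rmorphN1 !(sandwichDl, sandwichDr).
    rewrite !(sandwichZl, sandwichZr) !scalesmxA mulrNN mulr1 !scaleN1smx scale1smx.
    rewrite (scalesmxDl _ 1 1) scale1smx !opprD !opprK.
    move: (sandwich _ _ al) (sandwich _ _ al) (sandwich _ _ be) (sandwich _ _ be).
    move=> q p q' p'; rewrite (addrACA (p + q)) (addrACA p) subrr add0r.
    by rewrite (addrACA p') subrr addr0 (addrACA p') addrC.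
  have [r r0 rW] := psdmx_order_unit (- (4^-1 : C) *: W).
  exists r => //.
  have -> : ampmx e r%:C%:M + (y + starmx star y) =
      ampmx e (r%:C *: 1%:M + (- (4^-1 : C) *: W + (- (4^-1 : C) *: W)^t*)) +
      scalesmx (2^-1)%:C (ampmx e W + scalesmx 2 (y + starmx star y)).
    rewrite adjmxZ (psdmx_adj Wpsd) -scalerDl rmorphN fmorphV rmorph_nat.
    rewrite scalesmxDr scalesmxA -ampmxZ [RHS]addrA -ampmxD scalemx1.
    have -> : (2^-1)%:C = 2^-1 :> C by rewrite fmorphV rmorph_nat.
    rewrite mulVf ?pnatr_eq0 // scale1smx -addrA -scalerDl.
    have -> : - 4^-1 - 4^-1 + 2^-1 = 0 :> C by field.
    by rewrite scale0r addr0.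
  apply: posD => //; first exact: pos_amp.
  by apply: posZ => //; rewrite invr_ge0.
have Srank1 (al be : 'rV[C]_n) (v : V) : S (sandwich (al^t*) (v%:M : 'M_1) be).
  pose b := (2^-1 : C) *: (v + star v).
  pose j : C := 'i%R; pose c := (j / 2) *: (star v - v).
  have -> : sandwich (al^t*) (v%:M : 'M_1) be =
     sandwich (al^t*) (b%:M : 'M_1) be + sandwich (al^t*) (c%:M : 'M_1) (j *: be).
    rewrite sandwichZr -sandwichZ -sandwichD; congr sandwich.
    have {1}-> : v = b + j *: c.
      rewrite /b /c scalerA mulrA -expr2 /j sqrCi mulN1r scaleNr -scalerN opprB.
      rewrite -scalerDr addrACA subrr addr0 scalerDr -scalerDl.
      by rewrite (_ : 2^-1 + 2^-1 = 1 :> C) ?scale1r //; field.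
    by apply/matrixP => k l; rewrite !ord1 !mxE !mulr1n.
  apply: SD; apply: Ssa.
    rewrite /b starvZ // starvD // sP.1 addrC; congr (_ *: _).
    by rewrite fmorphV rmorph_nat.
  rewrite /c starvZ // starvD // sP.1 -(scaleN1r v) starvZ // rmorphN1 !scaleN1r.
  rewrite rmorphM /= /j conjCi fmorphV rmorph_nat mulNr scaleNr -scalerN opprB.
  by rewrite addrC.
rewrite -/(S x) (sandwich_delta x).
have S0 : S 0.
  exists 1 => //; rewrite starmx0 // !addr0; apply: (pos_amp n0).
  exact: psdmx_scalar.
elim/big_ind: _ => // k _; elim/big_ind: _ => // l _.
have := Srank1 (delta_mx 0 k) (delta_mx 0 l) (x k l).
by rewrite trmx_delta map_delta_mx.
Qed.

End OrderUnit.

(** * Completely positive maps *)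

Section PositiveMaps.
Context {R : realType} {V : matrixOrderUnitSpace R}.
Local Notation C := R[i].
Local Notation Re := (@complex.Re R).
Local Notation Im := (@complex.Im R).
Local Notation star := (@mou_star R V).
Local Notation pos := (@mou_pos R V _).
Local Notation e := (@mou_unit R V).

Lemma completely_positiveP r (f : {linear V -> 'M[C]_r}) : (0 < r)%N ->
  completely_positive f <-> forall x : 'M[V]_r, pos x -> 0 <= functional_of f x.
Proof.
move=> r0; split=> [fcp x /(fcp _ _ r0)/psdmx_pairingP/(_ 1%:M)|f0 n a n0 apos].
  by rewrite adjmx1 sandwich1.
by apply/psdmx_pairingP => X; apply/f0/pos_sandwich.
Qed.

Lemma functional_of_amp r (f : {linear V -> 'M[C]_r}) (B : 'M[C]_r) :
  functional_of f (ampmx e B) = \tr (B *m (f e)^T).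
Proof.
rewrite /mxtrace; apply: eq_bigr => k _; rewrite mxE; apply: eq_bigr => l _.
by rewrite !mxE linearZ mxE.
Qed.

Lemma functional_of_amp_ge0 r (f : {linear V -> 'M[C]_r}) (B : 'M[C]_r) :
  (0 < r)%N -> completely_positive f -> psdmx B ->
  0 <= functional_of f (ampmx e B).
Proof. by move=> r0 /(completely_positiveP _ r0) f0 /(pos_amp r0)/f0. Qed.

(** A positive functional is self-adjoint since every self-adjoint element is
    a difference of positive ones. *)
Lemma functional_of_star r (f : {linear V -> 'M[C]_r}) (x : 'M[V]_r) :
  (0 < r)%N -> completely_positive f ->
  functional_of f (starmx star x) = (functional_of f x)^*%R.
Proof.
move=> r0 fcp; have f0 := (completely_positiveP f r0).1 fcp.
have real_sa y : Im (functional_of f (y + starmx star y)) = 0.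
  have [t t0 /f0] := matrix_order_unit y r0; rewrite functional_ofD.
  have : 0 <= functional_of f (ampmx e t%:C%:M).
    by apply: (functional_of_amp_ge0 r0 fcp); apply: psdmx_scalar; exact: ltW.
  move: (functional_of _ _) (functional_of _ _) => z w.
  by move=> /ger0_Im z0 /ger0_Im; case: w z z0 => a b [c d] /= ->; rewrite add0r.
have := real_sa x; have := real_sa (scalesmx 'i%C x).
rewrite (starmxZ mou_starP) !functional_ofD !functional_ofZ !conjC_conjc.
move: (functional_of _ _) (functional_of _ _) => [a b] [c d] /=.
move=> h1 h2; apply/eqP; rewrite eq_complex /=.
by apply/andP; split; apply/eqP; lra.
Qed.

Lemma adj_col_mx m1 m2 n (A : 'M[C]_(m1, n)) (B : 'M[C]_(m2, n)) :
  (col_mx A B)^t* = row_mx (A^t*) (B^t*).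
Proof. by rewrite tr_col_mx map_row_mx. Qed.

Lemma starmx_block m1 m2 n1 n2 (a : 'M[V]_(m1, n1)) (b : 'M[V]_(m1, n2))
    (c : 'M[V]_(m2, n1)) (d : 'M[V]_(m2, n2)) :
  starmx star (block_mx a b c d) =
  block_mx (starmx star a) (starmx star c) (starmx star b) (starmx star d).
Proof. by rewrite /starmx tr_block_mx map_block_mx. Qed.

(** The amplifications of a unital completely positive map are contractive:
    evaluate the functional on the compression of the positive block matrix
    defining the norm by the column with entries [X] and [- Y]. *)
Lemma opnorm_pairing_le_mnorm n r (f : {linear V -> 'M[C]_r}) (a : 'M[V]_n) :
  (0 < n)%N -> (0 < r)%N -> completely_positive f -> f e = 1%:M ->
  opnorm (mx_pairing f a) <= mnorm a.
Proof.
move=> n0 r0 fcp fe; have f0 := (completely_positiveP f r0).1 fcp.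
have nn0 : (0 < n + n)%N by rewrite addn_gt0 n0.
apply: lb_le_inf => [|t /= tpos].
  have [t _] := matrix_order_unit (block_mx 0 a 0 0 : 'M[V]_(n + n)) nn0.
  rewrite starmx_block !(starmx0 mou_starP) add_block_mx !addr0 !add0r.
  rewrite scalar_mx_block /ampmx map_block_mx -!/(ampmx e _) => tpos.
  exists t; rewrite /= !scalar_ampmx; move: tpos; rewrite add_block_mx.
  have amp0 : ampmx e (0 : 'M[C]_n) = 0.
    by rewrite -(scale0r 0) ampmxZ scale0smx.
  by rewrite !amp0 !addr0 !add0r.
have bound (X Y : 'M[C]_(n, r)) :
    2 * Re (functional_of f (sandwich (X^t*) a Y)) <= t * (hsnorm2 X + hsnorm2 Y).
  have := f0 _ (pos_sandwich (col_mx X (- Y)) r0 nn0 tpos).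
  rewrite adj_col_mx sandwich_block !scalar_ampmx !sandwich_amp.
  rewrite -scaleN1r adjmxZ rmorphN1 !(sandwichZl, sandwichZr) !functional_ofD.
  rewrite !functional_ofZ -[X in sandwich _ (starmx _ _) X](trmxCK X).
  rewrite -(starmx_sandwich mou_starP) functional_of_star //.
  rewrite !functional_of_amp fe trmx1 !mulmx1 !mul_mx_scalar -!scalemxAl.
  rewrite !linearZ /= -!hsnorm2E.
  move=> /ge0_Re; rewrite !mulN1r opprK !ReD !ReN Re_conjc.
  rewrite !ReZ !Re_real.
  by lra.
suff t0 : 0 <= t by apply/opnorm_pairingP.
have := bound (const_mx 1) 0.
rewrite sandwich0r -(scale0smx 0) functional_ofZ mul0r mulr0 hsnorm2_0 addr0.
rewrite pmulr_lge0 // lt_neqAle hsnorm2_ge0 andbT eq_sym.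
apply/eqP => /hsnorm2_eq0/matrixP/(_ (Ordinal n0) (Ordinal r0)).
by rewrite !mxE => /eqP; rewrite oner_eq0.
Qed.

End PositiveMaps.

(** * Densities and corners *)

Section Densities.
Context {R : realType}.
Local Notation C := R[i].
Local Notation Re := (@complex.Re R).

(** The entries of [rho] are the values of [P] at the matrix units, transposed.
    Its form at [x] is the value of [P] at the rank one matrix [x x^*]. *)
Lemma density n (P : 'M[C]_n -> C) :
  (forall c x y, P (c *: x + y) = c * P x + P y) ->
  (forall h, psdmx h -> 0 <= P h) ->
  exists2 rho : 'M[C]_n, psdmx rho & forall h, P h = \tr (h *m rho).
Proof.
move=> Plin P0; have PD x y : P (x + y) = P x + P y.
  by have := Plin 1 x y; rewrite scale1r mul1r.
have P00 : P 0 = 0 by apply: (addrI (P 0)); rewrite -PD !addr0.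
have PZ c x : P (c *: x) = c * P x by have := Plin c x 0; rewrite P00 !addr0.
pose rho : 'M[C]_n := \matrix_(l, k) P (delta_mx k l).
have PE h : P h = \tr (h *m rho).
  rewrite {1}[h]matrix_sum_delta (big_morph P PD P00); apply: eq_bigr => k _.
  rewrite (big_morph P PD P00) mxE; apply: eq_bigr => l _.
  by rewrite PZ mxE.
exists rho => // x; rewrite -trace_mx11 mxtrace_mulC mulmxA -PE; apply: P0.
by rewrite -[X in X *m _](trmxCK x); apply: psdmx_gram.
Qed.

(** The perturbation by [de] makes the density definite, hence its factor
    invertible. *)
Lemma psdmx_add_scalar_factor n (rho : 'M[C]_n) (de : R) : 0 < de ->
  psdmx rho -> exists2 S : 'M[C]_n, S \in unitmx & rho + de%:C%:M = S^t* *m S.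
Proof.
move=> de0 rho0; have psd : psdmx (rho + de%:C%:M).
  by apply: (psdmxD rho0); apply: psdmx_scalar; exact: ltW.
have [S SE] := psdmx_factor psd; exists S => //.
have : S^t* *m S \in unitmx; last by rewrite unitmx_mul => /andP[].
rewrite -SE -row_free_unit -kermx_eq0; apply/rowV0P => v /sub_kermxP v0.
have := rho0 (v^t*); rewrite trmxCK => vr.
have : (v *m (rho + de%:C%:M) *m v^t*) 0 0 = 0 by rewrite v0 mul0mx mxE.
rewrite mulmxDr mulmxDl mxE mul_mx_scalar -scalemxAl [X in _ + X]mxE.
have -> : (v *m v^t*) 0 0 = (hsnorm2 (v^t*))%:C.
  by rewrite hsnorm2E trmxCK trace_mx11.
move=> /(congr1 Re); rewrite ReD ReZ Re_real => sum0.
suff : hsnorm2 (v^t*) = 0.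
  by move=> /hsnorm2_eq0 v0'; rewrite -(trmxCK v) v0' trmx0 map_mx0.
apply/eqP; rewrite eq_le hsnorm2_ge0 andbT -(pmulr_rle0 _ de0).
have Re0 : Re 0 = 0 by [].
rewrite -Re0 -sum0 lerDr.
by apply: ge0_Re.
Qed.

End Densities.

Section Corner.
Context {R : realType} {V : matrixOrderUnitSpace R}.
Local Notation C := R[i].
Local Notation Re := (@complex.Re R).
Local Notation star := (@mou_star R V).
Local Notation pos := (@mou_pos R V _).
Local Notation e := (@mou_unit R V).

Definition corner1 n : 'M[C]_(n, n + n) := row_mx 1%:M 0.
Definition corner2 n : 'M[C]_(n, n + n) := row_mx 0 1%:M.

Lemma corner1_adj n : (corner1 n)^t* = col_mx 1%:M 0.
Proof. by rewrite tr_row_mx map_col_mx adjmx1 trmx0 map_mx0. Qed.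

Lemma corner2_adj n : (corner2 n)^t* = col_mx 0 1%:M.
Proof. by rewrite tr_row_mx map_col_mx adjmx1 trmx0 map_mx0. Qed.

Lemma corner11 n : corner1 n *m (corner1 n)^t* = 1%:M.
Proof. by rewrite corner1_adj mul_row_col mulmx1 mulmx0 addr0. Qed.

Lemma corner22 n : corner2 n *m (corner2 n)^t* = 1%:M.
Proof. by rewrite corner2_adj mul_row_col mulmx1 mulmx0 add0r. Qed.

Lemma corner12 n : corner1 n *m (corner2 n)^t* = 0.
Proof. by rewrite corner2_adj mul_row_col mulmx1 mulmx0 addr0. Qed.

Lemma corner_sum n :
  (corner1 n)^t* *m corner1 n + (corner2 n)^t* *m corner2 n = 1%:M.
Proof.
rewrite corner1_adj corner2_adj !mul_col_row !(mul1mx, mul0mx, mulmx0).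
by rewrite add_block_mx !addr0 !add0r -scalar_mx_block.
Qed.

Lemma sandwich_col_row m1 m2 n p q1 q2 (A1 : 'M[C]_(m1, n)) (A2 : 'M[C]_(m2, n))
    (v : 'M[V]_(n, p)) (B1 : 'M[C]_(p, q1)) (B2 : 'M[C]_(p, q2)) :
  sandwich (col_mx A1 A2) v (row_mx B1 B2) =
  block_mx (sandwich A1 v B1) (sandwich A1 v B2)
           (sandwich A2 v B1) (sandwich A2 v B2).
Proof.
apply/matrixP => i j; rewrite sandwichE.
case: (split_ordP i) => k ->; case: (split_ordP j) => l ->;
  rewrite ?(block_mxEul, block_mxEur, block_mxEdl, block_mxEdr) sandwichE;
  apply: eq_bigr => s _; apply: eq_bigr => t _;
  by rewrite ?(col_mxEu, col_mxEd) ?(row_mxEl, row_mxEr).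
Qed.

Lemma ampmx0 m n : ampmx e (0 : 'M[C]_(m, n)) = 0.
Proof. by rewrite -(scale0r 0) ampmxZ scale0smx. Qed.

Lemma starmx_amp_real n (t : R) :
  starmx star (ampmx e (t%:C%:M : 'M_n)) = ampmx e t%:C%:M.
Proof.
rewrite starmx_amp ?mou_starP ?(mou_order_unit V).1 //.
  by rewrite -scalemx1 adjmxZ adjmx1 conj_real.
exact: mou_starP.
Qed.

(** With [U = p1 - p2] this is the standard averaging trick: conjugation by [U]
    changes the sign of the two off-diagonal terms only. *)
Lemma sandwich_offdiag n (D : 'M[V]_n) (p1 p2 : 'M[C]_n) : p1 + p2 = 1%:M ->
  sandwich p1 D p2 + sandwich p2 D p1 =
  scalesmx (2^-1)%:C (D - sandwich (p1 - p2) D (p1 - p2)).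
Proof.
move=> p12; have combine (U : zmodType) (w x y z : U) :
    w + x + (y + z) - (w - x + (- y - - z)) = y + x + (y + x).
  rewrite -opprD opprB [y - z - _]addrC opprB addrACA (addrC w) (addrACA x) subrr addr0.
  by rewrite (addrACA y z) subrr addr0 addrACA [x + y]addrC.
rewrite -{3}[D]sandwich1 -p12 -[- p2]scaleN1r.
rewrite (sandwichDr _ D p1 p2) !(sandwichDl p1 p2).
rewrite (sandwichDr _ D p1 (-1 *: p2)) !(sandwichDl p1 (-1 *: p2)).
rewrite !(sandwichZr _ _ _ p2) !(sandwichZl _ p2) !scaleN1smx combine.
rewrite scalesmxDr -scalesmxDl -rmorphD.
by have -> : 2^-1 + 2^-1 = 1 :> R; [field|rewrite rmorph1 scale1smx].
Qed.

(** With [U = diag(1, - 1)], the average of the positive matrices [t + D] and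
    [U (t - D) U] is the block matrix of [t], [b], [b^*], [t] that defines the
    norm of the off-diagonal block [b] of [D]. *)
Lemma mnorm_corner n (D : 'M[V]_(n + n)) (t : R) : (0 < n)%N -> 0 <= t ->
  pos (ampmx e t%:C%:M + D) -> pos (ampmx e t%:C%:M - D) ->
  mnorm (sandwich (corner1 n) D ((corner2 n)^t*)) <= t.
Proof.
move=> n0 t0 tD tND; have nn0 : (0 < n + n)%N by rewrite addn_gt0 n0.
set b := sandwich _ _ _.
have Dsa : starmx star D = D.
  have := pos_self_adjoint nn0 tD; rewrite starmxD; last exact: mou_starP.
  by rewrite starmx_amp_real => /addrI.
pose p1 := (corner1 n)^t* *m corner1 n; pose p2 := (corner2 n)^t* *m corner2 n.
have p1a : p1^t* = p1 by rewrite adjmxM trmxCK.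
have p2a : p2^t* = p2 by rewrite adjmxM trmxCK.
have blockE : block_mx (t%:C *: e)%:M b (starmx star b) (t%:C *: e)%:M =
    ampmx e t%:C%:M + (sandwich p1 D p2 + sandwich p2 D p1).
  rewrite -!sandwich_comp -/b; have -> : sandwich (corner2 n) D ((corner1 n)^t*) =
      starmx star b.
    by rewrite starmx_sandwich ?trmxCK ?Dsa //; exact: mou_starP.
  rewrite corner1_adj corner2_adj /corner1 /corner2 !sandwich_col_row !sandwich1.
  rewrite !(sandwich0l, sandwich0r) add_block_mx !addr0 !add0r.
  rewrite scalar_mx_block /ampmx map_block_mx -!/(ampmx e _) !ampmx0.
  by rewrite add_block_mx !addr0 !add0r !scalar_ampmx.
have posU := pos_sandwich (p1 - p2) nn0 nn0 tND.
suff Epos : block_mx (t%:C *: e)%:M b (starmx star b) (t%:C *: e)%:M =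
    scalesmx (2^-1)%:C ((ampmx e t%:C%:M + D) +
      sandwich ((p1 - p2)^t*) (ampmx e t%:C%:M - D) (p1 - p2)).
  have Bpos : pos (block_mx (t%:C *: e)%:M b (starmx star b) (t%:C *: e)%:M).
    by rewrite Epos; apply: (posZ nn0); [rewrite invr_ge0|exact: posD].
  rewrite /mnorm; set S := [set s | _].
  have [Slb|nSlb] := pselect (has_lbound S); first exact: (ge_inf Slb Bpos).
  by rewrite inf_out // => -[_].
rewrite blockE.
have -> : (p1 - p2)^t* = p1 - p2.
  by rewrite adjmxD p1a -scaleN1r adjmxZ rmorphN1 p2a.
have p11 : p1 *m p1 = p1.
  by rewrite /p1 mulmxA -[_ *m corner1 n *m _]mulmxA corner11 mulmx1.
have p22 : p2 *m p2 = p2.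
  by rewrite /p2 mulmxA -[_ *m corner2 n *m _]mulmxA corner22 mulmx1.
have p12 : p1 *m p2 = 0.
  by rewrite /p1 /p2 mulmxA -[_ *m corner1 n *m _]mulmxA corner12 mulmx0 mul0mx.
have p21 : p2 *m p1 = 0.
  by rewrite -p1a -p2a -adjmxM p12 trmx0 map_mx0.
have p12D : p1 + p2 = 1%:M by exact: corner_sum.
have UU : (p1 - p2) *m t%:C%:M *m (p1 - p2) = t%:C%:M.
  rewrite mul_mx_scalar -scalemxAl mulmxBr (mulmxBl p1 p2 p1) (mulmxBl p1 p2 p2).
  rewrite p11 p12 p21 p22 sub0r subr0.
  by rewrite opprK p12D scalemx1.
rewrite sandwichD sandwich_amp UU sandwichN (sandwich_offdiag D p12D).
rewrite addrACA [RHS]scalesmxDr; congr (_ + _).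
rewrite scalesmxDr -scalesmxDl -rmorphD.
by have -> : 2^-1 + 2^-1 = 1 :> R; [field|rewrite rmorph1 scale1smx].
Qed.

End Corner.

(** * Products of the Lipschitz unit ball with scalar matrices *)

Section Generators.
Context {R : realType} {V : matrixOrderUnitSpace R} (L : forall n, 'M[V]_n -> R).
Local Notation C := R[i].
Local Notation Re := (@complex.Re R).
Local Notation Im := (@complex.Im R).
Local Notation star := (@mou_star R V).
Local Notation pos := (@mou_pos R V _).
Local Notation e := (@mou_unit R V).
Hypothesis mlsL : matrix_lipschitz_seminorm L.

Definition herm n (x : 'M[V]_n) := x + starmx star x.

Lemma hermD n (x y : 'M[V]_n) : herm (x + y) = herm x + herm y.
Proof. by rewrite /herm (starmxD mou_starP) addrACA. Qed.

Lemma hermZ n (t : R) (x : 'M[V]_n) :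
  herm (scalesmx t%:C x) = scalesmx t%:C (herm x).
Proof. by rewrite /herm (starmxZ mou_starP) conj_real scalesmxDr. Qed.

Lemma hermN n (x : 'M[V]_n) : herm (- x) = - herm x.
Proof. by rewrite /herm (starmxN mou_starP) opprD. Qed.

Lemma herm0 n : herm (0 : 'M[V]_n) = 0.
Proof. by rewrite /herm (starmx0 mou_starP) addr0. Qed.

Lemma herm_pos n (x : 'M[V]_n) : (0 < n)%N -> pos x -> pos (herm x).
Proof. by move=> n0 x0; rewrite /herm pos_self_adjoint //; apply: posD. Qed.

Lemma herm_skew n (x : 'M[V]_n) : (0 < n)%N -> pos x -> herm (scalesmx 'i%C x) = 0.
Proof.
move=> n0 x0; rewrite /herm (starmxZ mou_starP) pos_self_adjoint //.
by rewrite conjCi -scalesmxDl subrr scale0smx.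
Qed.

Lemma lipschitz0 n : (0 < n)%N -> L (0 : 'M[V]_n) = 0.
Proof.
move=> n0; have [_ _ LZ] := mls_seminorm mlsL n0.
by rewrite -(scale0smx 0) LZ Normc.normc0 mul0r.
Qed.

(** The matrix [c] measures the cost of writing [k] as a product over the unit
    ball. By the direct sum axiom the costs of two products add up, so these
    pairs form a convex cone. *)
Definition ball_product N (k : 'M[V]_N) (c : 'M[C]_N) : Prop :=
  exists r (v : 'M[V]_r) (al be : 'M[C]_(r, N)), [/\ (0 < r)%N, L v <= 1,
    k = sandwich (al^t*) v be & c = al^t* *m al + be^t* *m be].

Lemma ball_product0 N : ball_product (0 : 'M[V]_N) 0.
Proof.
exists 1%N, 0, 0, 0; rewrite lipschitz0 // sandwich0 !mulmx0 addr0.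
by split.
Qed.

Lemma ball_productD N (k k' : 'M[V]_N) c c' :
  ball_product k c -> ball_product k' c' -> ball_product (k + k') (c + c').
Proof.
move=> [r [v [al [be [r0 Lv -> ->]]]]] [r' [v' [al' [be' [r0' Lv' -> ->]]]]].
exists (r + r')%N, (block_mx v 0 0 v'), (col_mx al al'), (col_mx be be').
split; first by rewrite addn_gt0 r0.
- by rewrite mls_dsum // ge_max Lv Lv'.
- by rewrite adj_col_mx sandwich_block !sandwich0 addr0 add0r.
- by rewrite !adj_col_mx !mul_row_col addrACA.
Qed.

Lemma ball_productZ N (t : R) (k : 'M[V]_N) c : 0 <= t -> ball_product k c ->
  ball_product (scalesmx t%:C k) (t%:C *: c).
Proof.
move=> t0 [r [v [al [be [r0 Lv -> ->]]]]].
have tt : (Num.sqrt t)%:C * (Num.sqrt t)%:C = t%:C.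
  by rewrite -rmorphM -expr2 sqr_sqrtr.
exists r, v, ((Num.sqrt t)%:C *: al), ((Num.sqrt t)%:C *: be); split=> //.
  by rewrite adjmxZ conj_real sandwichZl sandwichZr scalesmxA tt.
rewrite !adjmxZ conj_real -!scalemxAl -!scalemxAr !scalerA tt -scalerDr.
by [].
Qed.

Lemma opnorm_col_le n r N (al be : 'M[C]_(r, N)) (s : 'M[C]_(n, N)) (t : R) :
  0 <= t -> s *m s^t* = 1%:M ->
  psdmx (t%:C%:M - (al^t* *m al + be^t* *m be)) ->
  opnorm (col_mx (al *m s^t*) (be *m s^t*)) <= Num.sqrt t.
Proof.
move=> t0 ss psd; apply: opnorm_le => [|x]; first exact: sqrtr_ge0.
rewrite sqr_sqrtr // mul_col_mx -!mulmxA; set y := s^t* *m x.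
have -> : hsnorm2 x = hsnorm2 y.
  apply: (@complexI R); rewrite !hsnorm2E /y adjmxM trmxCK mulmxA.
  by rewrite -[_ *m s *m _]mulmxA ss mulmx1.
have -> : hsnorm2 (col_mx (al *m y) (be *m y)) = hsnorm2 (al *m y) + hsnorm2 (be *m y).
  apply: (@complexI R).
  by rewrite rmorphD /= !hsnorm2E adj_col_mx mul_row_col mxtraceD.
have := ge0_Re (psd y); rewrite -/(mxform _ y y) -scalemx1.
rewrite mxformD mxformZ mxform1 mxformN mxformD !mxform_gram.
by rewrite ReD ReN ReD ReZ !Re_real subr_ge0.
Qed.

(** The corner is the product of a row, of [v] and [v^*] on the diagonal, and of
    a column, where the row and the column have norm at most the square root of
    [t]; the Lipschitz axioms do the rest. *)
Lemma lipschitz_corner_le n r N (v : 'M[V]_r) (al be : 'M[C]_(r, N))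
    (s1 s2 : 'M[C]_(n, N)) (t : R) : (0 < n)%N -> (0 < r)%N -> 0 <= t ->
  L v <= 1 -> s1 *m s1^t* = 1%:M -> s2 *m s2^t* = 1%:M ->
  psdmx (t%:C%:M - (al^t* *m al + be^t* *m be)) ->
  L (sandwich s1 (herm (sandwich (al^t*) v be)) (s2^t*)) <= t.
Proof.
move=> n0 r0 t0 Lv s11 s22 psd.
pose A := col_mx (al *m s1^t*) (be *m s1^t*).
pose B := col_mx (be *m s2^t*) (al *m s2^t*).
have -> : sandwich s1 (herm (sandwich (al^t*) v be)) (s2^t*) =
    sandwich (A^t*) (block_mx v 0 0 (starmx star v)) B.
  rewrite adj_col_mx sandwich_block !sandwich0 addr0 add0r !adjmxM !trmxCK.
  rewrite /herm (starmx_sandwich mou_starP) trmxCK sandwichD !sandwich_comp.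
  by [].
have opA : opnorm (A^t*) <= Num.sqrt t.
  by apply: opnorm_adj_le; [exact: sqrtr_ge0|exact: opnorm_col_le].
have opB : opnorm B <= Num.sqrt t.
  by apply: (opnorm_col_le t0 s22); rewrite [be^t* *m be + _]addrC.
have rr0 : (0 < r + r)%N by rewrite addn_gt0 r0.
apply: le_trans (mls_mul mlsL _ _ _ rr0 n0) _.
rewrite mls_dsum // mls_star // maxxx -[leRHS]sqr_sqrtr // expr2.
apply: ler_pM => //; rewrite ?mulr_ge0 ?opnorm_ge0 //.
  by have [L0 _ _] := mls_seminorm mlsL r0.
rewrite -[leRHS]mulr1; apply: ler_pM => //; rewrite ?opnorm_ge0 //.
by have [L0 _ _] := mls_seminorm mlsL r0.
Qed.

(** Closedness of the ball of radius [t], in quantitative form. *)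
Lemma lower_semicontinuous_gap n (a : 'M[V]_n) (t : R) : lower_semicontinuous_seminorm L ->
  (0 < n)%N -> 0 < t -> t < L a ->
  exists2 eps : R, 0 < eps & forall b, L b <= t -> eps <= mnorm (a - b).
Proof.
move=> lsc n0 t0 ta; apply: contrapT => nogap.
move: ta; rewrite ltNge => /negP; apply; apply: (lsc n t n0 t0 a) => eps eps0.
apply: contrapT => nob; apply: nogap; exists eps => // b Lb.
by rewrite leNgt; apply/negP => ab; apply: nob; exists b.
Qed.

End Generators.

(** * The separating functionals *)

Section Separation.
Context {R : realType} {V : matrixOrderUnitSpace R} (L : forall n, 'M[V]_n -> R).
Local Notation C := R[i].
Local Notation Re := (@complex.Re R).
Local Notation Im := (@complex.Im R).
Local Notation star := (@mou_star R V).
Local Notation pos := (@mou_pos R V _).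
Local Notation e := (@mou_unit R V).
Hypothesis mlsL : matrix_lipschitz_seminorm L.

(** Used for functionals that vanish on skew elements: there the last two
    hypotheses say that the value is real. *)
Lemma ge0_of_Re (z : C) :
  0 <= Re z -> 0 <= Re ('i%C * z) -> 0 <= Re (- 'i%C * z) -> 0 <= z.
Proof.
case: z => a b /= a0; rewrite !mul0r !mul1r !mulN1r => b1 b2.
by apply: ge0P => //=; lra.
Qed.

(** Positivity is imposed on [x + x^*] rather than on [x], so that the cone
    contains every skew element; a functional positive on it is then
    automatically self-adjoint. *)
Definition separation_cone N (p : vmx V N N * vmx V N N * 'M[C]_N) : Prop :=
  exists k c, [/\ ball_product L k c, pos (herm (p.1.1 + k)), pos (herm (p.1.2 - k)) &
    psdmx (p.2 + p.2^t* - c)].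

Lemma separation_cone_is_cone N : (0 < N)%N -> is_cone (@separation_cone N).
Proof.
move=> N0; split=> [|[[x y] h] [[x' y'] h']|t [[x y] h] t0].
- exists 0, 0; split; rewrite /= ?addr0 ?subr0 ?herm0; try exact: pos0.
    exact: ball_product0.
  by rewrite trmx0 map_mx0 addr0; exact: psdmx0.
- move=> [k [c [kc xk yk hc]]] [k' [c' [kc' xk' yk' hc']]].
  exists (k + k'), (c + c'); split; first exact: ball_productD.
  + by rewrite /= addrACA hermD; apply: posD.
  + by rewrite /= opprD addrACA hermD; apply: posD.
  + rewrite /= adjmxD opprD (addrACA h h') (addrACA (h + _)).
    exact: (psdmxD hc hc').
- move=> [k [c [kc xk yk hc]]]; exists (scalesmx t%:C k), (t%:C *: c).
  split; first exact: ball_productZ.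
  + by rewrite /= -[_ *: x]/(scalesmx t%:C x) -scalesmxDr hermZ; apply: posZ.
  + rewrite /= -[_ *: y]/(scalesmx t%:C y) -scaleN1smx scalesmxA mulrC.
    by rewrite -scalesmxA -scalesmxDr hermZ scaleN1smx; apply: posZ.
  + rewrite /= adjmxZ conj_real -scalerDr -scalerBr; apply: psdmxZ => //.
    by rewrite ler0c.
Qed.

Lemma herm_amp n (t : R) :
  herm (ampmx e (t%:C%:M : 'M_n)) = ampmx e (2 * t)%:C%:M.
Proof.
rewrite /herm starmx_amp_real -ampmxD -raddfD -rmorphD.
by rewrite mulrDl mul1r.
Qed.

Definition separation_unit N : vmx V N N * vmx V N N * 'M[C]_N :=
  (ampmx e 1%:M, ampmx e 1%:M, 1%:M).

Lemma separation_cone_unit N p : (0 < N)%N ->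
  exists2 t : R, 0 < t & separation_cone (t%:C *: separation_unit N + p).
Proof.
move=> N0; case: p => -[x y] h.
have [t t0 xt] := matrix_order_unit x N0.
have [s s0 ys] := matrix_order_unit y N0.
have [r r0 hr] := psdmx_order_unit h.
exists (t + s + r); first by rewrite !addr_gt0.
have amp_ge0 (u : R) : 0 <= u -> pos (ampmx e (u%:C%:M : 'M_N)).
  by move=> /psdmx_scalar -/(_ N)/(pos_amp N0).
have unitE (u : R) : u%:C *: (ampmx e 1%:M : vmx V N N) = ampmx e u%:C%:M.
  by rewrite -[RHS]/(ampmx e (u%:C%:M)) -[in RHS]scalemx1 ampmxZ.
exists 0, 0; split; [exact: ball_product0| | |].
- rewrite /= addr0 unitE hermD herm_amp.
  have -> : 2 * (t + s + r) = t + (t + 2 * (s + r)) by ring.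
  rewrite [(t + _)%:C]rmorphD raddfD ampmxD addrAC; apply: posD => //.
  by apply: amp_ge0; rewrite addr_ge0 ?mulr_ge0 ?addr_ge0 ?ltW.
- rewrite /= subr0 unitE hermD herm_amp.
  have -> : 2 * (t + s + r) = s + (s + 2 * (t + r)) by ring.
  rewrite [(s + _)%:C]rmorphD raddfD ampmxD addrAC; apply: posD => //.
  by apply: amp_ge0; rewrite addr_ge0 ?mulr_ge0 ?addr_ge0 ?ltW.
- rewrite /= subr0 adjmxD adjmxZ conj_real adjmx1 addrACA -scalerDl -rmorphD.
  have -> : t + s + r + (t + s + r) = r + (r + 2 * (t + s)) by ring.
  rewrite rmorphD scalerDl addrAC.
  apply: (psdmxD hr); rewrite scalemx1; apply: psdmx_scalar.
  by rewrite addr_ge0 ?mulr_ge0 ?addr_ge0 ?ltW.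
Qed.

Definition offdiag_embedding n (a : 'M[V]_n) : 'M[V]_(n + n) :=
  sandwich ((corner1 n)^t*) a (corner2 n).

(** If the point were in the cone, the corner of [k + k^*] would have Lipschitz
    seminorm at most [t], since its cost is at most [t], while being closer to
    [a] than the gap allows. The term [eps / 4] is doubled by adding the
    adjoint, so the distance is at most [eps / 2]. *)
Lemma separation_cone_target n (a : 'M[V]_n) (t eps : R) : (0 < n)%N -> 0 < t -> 0 < eps ->
  (forall b, L b <= t -> eps <= mnorm (a - b)) ->
  ~ separation_cone (- offdiag_embedding a + ampmx e (eps / 4)%:C%:M,
              offdiag_embedding a + ampmx e (eps / 4)%:C%:M, (t / 2)%:C%:M).
Proof.
move=> n0 t0 eps0 gap [k [c [[r [v [al [be [r0 Lv -> ->]]]]]]]] /=.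
set w := offdiag_embedding a; set k0 := sandwich _ v be => wk wNk psd.
pose D := herm (w - k0).
have halfeps : 2 * (eps / 4) = eps / 2 by field.
have tD : pos (ampmx e (eps / 2)%:C%:M + D).
  move: wNk; rewrite addrAC hermD herm_amp halfeps.
  by rewrite [herm _ + _]addrC.
have tND : pos (ampmx e (eps / 2)%:C%:M - D).
  move: wk; rewrite addrAC hermD herm_amp halfeps.
  by rewrite /D -hermN opprB [- w + _]addrC [herm _ + _]addrC.
have heps : 0 <= eps / 2 by rewrite divr_ge0 ?ltW.
have := mnorm_corner n0 heps tD tND.
have -> : sandwich (corner1 n) D ((corner2 n)^t*) =
    a - sandwich (corner1 n) (herm k0) ((corner2 n)^t*).
  rewrite /D hermD hermN sandwichD sandwichN; congr (_ - _).
  rewrite /herm /w /offdiag_embedding sandwichD (starmx_sandwich mou_starP) trmxCK.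
  rewrite !sandwich_comp corner11 corner22 corner12 sandwich0l addr0 sandwich1.
  by [].
apply/negP; rewrite -ltNge; apply: lt_le_trans (gap _ _).
  by rewrite ltr_pdivrMr // mulr_natr mulr2n ltrDl.
apply: (lipschitz_corner_le mlsL n0 r0 (ltW t0) Lv (corner11 n) (corner22 n)).
move: psd; rewrite -scalemx1 adjmxZ conj_real adjmx1 -scalerDl -rmorphD.
by rewrite -splitr scalemx1; apply.
Qed.

Definition linear_form N (F : 'M[V]_N -> C) :=
  forall c x y, F (scalesmx c x + y) = c * F x + F y.

(** [F1], [F2] and [P] are the three components of the functional given by
    [cone_separation]. The margin [ga] comes from two sources: the excess of an
    intermediate [t] over [t'], weighted by the mass [p] of [P] at the identity,
    and [eps], weighted by the remaining mass [1 - p]. *)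
Lemma separating_functionals n (a : 'M[V]_n) (t' : R) :
  lower_semicontinuous_seminorm L -> (0 < n)%N -> 0 <= t' -> t' < L a ->
  exists (F1 F2 : 'M[V]_(n + n) -> C) (P : 'M[C]_(n + n) -> C) (ga : R),
    [/\ [/\ linear_form F1, linear_form F2 &
            forall c x y, P (c *: x + y) = c * P x + P y],
        [/\ forall x, pos x -> 0 <= F1 x, forall x, pos x -> 0 <= F2 x &
            forall h, psdmx h -> 0 <= P h],
        forall r (v : 'M[V]_r) (al be : 'M[C]_(r, n + n)), (0 < r)%N -> L v <= 1 ->
          2 * Re (F1 (sandwich (al^t*) v be) - F2 (sandwich (al^t*) v be)) <=
          Re (P (al^t* *m al + be^t* *m be)),
        0 < ga &
        t' * Re (P 1%:M) + ga <=
        2 * Re (F1 (offdiag_embedding a) - F2 (offdiag_embedding a))].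
Proof.
move=> lsc n0 t'0 t'a; pose t := (t' + L a) / 2.
have [t't ta] := midf_lt t'a; rewrite -/t in t't ta.
have t0 : 0 < t by apply: le_lt_trans t't.
have [eps eps0 gap] := lower_semicontinuous_gap lsc n0 t0 ta.
have N0 : (0 < n + n)%N by rewrite addn_gt0 n0.
have [G [Glin GQ Gu Gz]] := cone_separation (separation_cone_is_cone N0)
  (fun p => separation_cone_unit p N0) (separation_cone_target n0 t0 eps0 gap).
have GD x y : G (x + y) = G x + G y.
  by have := Glin 1 x y; rewrite scale1r mul1r.
have G0 : G 0 = 0 by apply: (addrI (G 0)); rewrite -GD !addr0.
have GZ c x : G (c *: x) = c * G x by have := Glin c x 0; rewrite G0 !addr0.
pose F1 (x : 'M[V]_(n + n)) := G (x : vmx V _ _, 0, 0).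
pose F2 (x : 'M[V]_(n + n)) := G (0, x : vmx V _ _, 0).
pose P (h : 'M[C]_(n + n)) := G (0, 0, h).
have GE x y h : G (x, y, h) = F1 x + F2 y + P h.
  rewrite -!GD; congr G.
  transitivity (x + 0 + 0 : vmx V _ _, 0 + y + 0 : vmx V _ _, 0 + 0 + h) => //.
  by rewrite !addr0 !add0r.
have hermQ x y h : pos (herm x) -> pos (herm y) -> psdmx (h + h^t*) ->
    0 <= Re (G (x, y, h)).
  move=> x0 y0 h0; apply: GQ; exists 0, 0.
  by rewrite /= addr0 !subr0; split=> //; exact: ball_product0.
have p0 : pos (herm (0 : 'M[V]_(n + n))) by rewrite herm0; exact: pos0.
have h0 : psdmx ((0 : 'M[C]_(n + n)) + 0^t*).
  by rewrite trmx0 map_mx0 addr0; exact: psdmx0.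
have skew (x : 'M[V]_(n + n)) : pos x -> pos (herm (scalesmx 'i%C x)) /\
    pos (herm (scalesmx (- 'i%C) x)).
  move=> x0; rewrite -[- 'i%C]mulN1r -scalesmxA scaleN1smx hermN.
  by rewrite herm_skew // oppr0; split; exact: pos0.
pose z0 : vmx V (n + n) (n + n) := 0; pose h00 : 'M[C]_(n + n) := 0.
have F1_0 : F1 0 = 0 by rewrite -[RHS]G0.
have F2_0 : F2 0 = 0 by rewrite -[RHS]G0.
have P_0 : P 0 = 0 by rewrite -[RHS]G0.
have F1lin : linear_form F1.
  move=> c x y; rewrite /F1 -Glin; congr G.
  transitivity (c *: (x : vmx V (n + n) (n + n)) + y, c *: z0 + z0, c *: h00 + h00) => //.
  by rewrite /z0 /h00 !scaler0 !addr0.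
have F2lin : linear_form F2.
  move=> c x y; rewrite /F2 -Glin; congr G.
  transitivity (c *: z0 + z0, c *: (x : vmx V (n + n) (n + n)) + y, c *: h00 + h00) => //.
  by rewrite /z0 /h00 !scaler0 !addr0.
have Plin c x y : P (c *: x + y) = c * P x + P y.
  rewrite /P -Glin; congr G.
  transitivity (c *: z0 + z0, c *: z0 + z0, c *: x + y) => //.
  by rewrite /z0 /h00 !scaler0 !addr0.
have F1Z c x : F1 (scalesmx c x) = c * F1 x.
  by have := F1lin c x 0; rewrite F1_0 !addr0.
have F2Z c x : F2 (scalesmx c x) = c * F2 x.
  by have := F2lin c x 0; rewrite F2_0 !addr0.
have F1ge0 x : pos x -> 0 <= F1 x.
  move=> x0; have [ix nix] := skew x x0.
  by apply: ge0_of_Re; rewrite -?F1Z; apply: hermQ => //; exact: herm_pos.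
have F2ge0 x : pos x -> 0 <= F2 x.
  move=> x0; have [ix nix] := skew x x0.
  by apply: ge0_of_Re; rewrite -?F2Z; apply: hermQ => //; exact: herm_pos.
have conji : ('i%C : C)^*%R = - 'i%C by exact: conjCi.
have Pge0 h : psdmx h -> 0 <= P h.
  move=> hpsd; have PZ c : P (c *: h) = c * P h.
    by have := Plin c h 0; rewrite P_0 !addr0.
  have hskew (c : C) : c^*%R = - c -> psdmx (c *: h + (c *: h)^t*).
    move=> cc; rewrite adjmxZ (psdmx_adj hpsd) cc -scalerDl subrr scale0r.
    exact: psdmx0.
  apply: ge0_of_Re; rewrite -?PZ; apply: (hermQ _ _ _ p0 p0).
  - by rewrite (psdmx_adj hpsd); exact: (psdmxD hpsd hpsd).
  - by apply: hskew; exact: conji.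
  - by apply: hskew; rewrite rmorphN; congr (- _); exact: conji.
have psd1 : psdmx (1%:M : 'M[C]_(n + n)) := @psdmx1 R (n + n).
have ampp : pos (ampmx e (1%:M : 'M_(n + n))) := pos_amp N0 psd1.
pose p := Re (P 1%:M).
have p_ge0 : 0 <= p by apply/ge0_Re/Pge0.
have f1_ge0 := ge0_Re (F1ge0 _ ampp).
have f2_ge0 := ge0_Re (F2ge0 _ ampp).
have sum1 : Re (F1 (ampmx e 1%:M)) + Re (F2 (ampmx e 1%:M)) + p = 1.
  by rewrite -Gu GE !ReD.
pose ga := Num.min (t - t') (eps / 2).
exists F1, F2, P, ga; split=> //.
- move=> r v al be r0 Lv; set k := sandwich _ _ _; set c := _^t* *m _ + _.
  have csa : c^t* = c by rewrite adjmxD !adjmxM !trmxCK.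
  have : 0 <= Re (G (- k : vmx V (n + n) (n + n), k : vmx V (n + n) (n + n),
                     (2^-1)%:C *: c)).
    apply: GQ; exists k, c; split=> /=.
    + by exists r, v, al, be.
    + by rewrite addNr.
    + by rewrite subrr.
    + rewrite adjmxZ conj_real csa -scalerDl -rmorphD.
      have -> : 2^-1 + 2^-1 = 1 :> R by field.
      by rewrite rmorph1 scale1r subrr; exact: psdmx0.
  have PZ : P ((2^-1)%:C *: c) = (2^-1)%:C * P c.
    by have := Plin (2^-1)%:C c 0; rewrite P_0 !addr0.
  rewrite GE PZ -scaleN1smx F1Z mulN1r !ReD !ReN ReZ => ineq.
  by lra.
- by rewrite lt_min subr_gt0 t't divr_gt0.
- set w := offdiag_embedding a in Gz *.
  have F1D x y : F1 (x + y) = F1 x + F1 y.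
    by have := F1lin 1 x y; rewrite scale1smx mul1r.
  have F2D x y : F2 (x + y) = F2 x + F2 y.
    by have := F2lin 1 x y; rewrite scale1smx mul1r.
  have PZ : P (t / 2)%:C%:M = (t / 2)%:C * P 1%:M.
    by have := Plin (t / 2)%:C 1%:M 0; rewrite P_0 !addr0 scalemx1.
  have ampE (u : R) : ampmx e (u%:C%:M : 'M_(n + n)) = scalesmx u%:C (ampmx e 1%:M).
    by rewrite -ampmxZ scalemx1.
  move: Gz; rewrite GE PZ ampE F1D F2D F1Z F2Z -scaleN1smx F1Z mulN1r.
  rewrite !ReD !ReZ !ReN -/p => Gz.
  have ga1 : ga <= t - t' by rewrite ge_min lexx.
  have ga2 : ga <= eps / 2 by rewrite ge_min lexx orbT.
  have p_le1 : p <= 1 by lra.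
  have ? : ga * p <= (t - t') * p by rewrite ler_wpM2r.
  have ? : ga * (1 - p) <= eps / 2 * (1 - p) by rewrite ler_wpM2r // subr_ge0.
  by nra.
Qed.

End Separation.

(** * The separating completely positive maps *)

Section SeparatingMaps.
Context {R : realType} {V : matrixOrderUnitSpace R} (L : forall n, 'M[V]_n -> R).
Local Notation C := R[i].
Local Notation Re := (@complex.Re R).
Local Notation pos := (@mou_pos R V _).
Local Notation e := (@mou_unit R V).
Hypothesis mlsL : matrix_lipschitz_seminorm L.

(** Perturb the density of [P] into an invertible [S^* S] and conjugate [F1] and
    [F2] by the inverse [si] of [S^*]: substituting [X si] and [Y si] for [al]
    and [be] in the bound by [P] gives the bound by Hilbert--Schmidt norms. The
    target is reached at [X = s1 S^*] and [Y = s2 S^*]. *)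
Lemma separating_maps n (a : 'M[V]_n) (t : R) :
  lower_semicontinuous_seminorm L -> (0 < n)%N -> 0 <= t -> t < L a ->
  exists N (f g : {linear V -> 'M[C]_N}),
    [/\ (0 < N)%N, completely_positive f, completely_positive g,
        forall r (v : 'M[V]_r), (0 < r)%N -> L v <= 1 ->
          opnorm (mx_pairing f v - mx_pairing g v) <= 1 &
        t < opnorm (mx_pairing f a - mx_pairing g a)].
Proof.
move=> lsc n0 t0 ta.
have [F1 [F2 [P [ga [[F1lin F2lin Plin] [F1ge0 F2ge0 Pge0] bound ga0 target]]]]] :=
  separating_functionals mlsL lsc n0 t0 ta.
have N0 : (0 < n + n)%N by rewrite addn_gt0 n0.
have [rho rho0 PE] := density Plin Pge0.
pose N : R := (n + n)%:R; have Nge0 : 0 <= N by exact: ler0n.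
(* The perturbation adds [t * de * N] to the bound at the target; this choice
   keeps it below the margin [ga]. *)
pose de := ga / (t * N + 1).
have den0 : 0 < t * N + 1 by rewrite ltr_wpDl // mulr_ge0.
have de0 : 0 < de by rewrite divr_gt0.
have [S Sunit SE] := psdmx_add_scalar_factor de0 rho0.
pose si := invmx (S^t*).
have Ssi : S^t* *m si = 1%:M by rewrite mulmxV // map_unitmx unitmx_tr.
have siS : si *m S^t* = 1%:M by rewrite mulVmx // map_unitmx unitmx_tr.
have hsP m (T : 'M[C]_(m, n + n)) :
    hsnorm2 (T *m S^t*) = Re (P (T^t* *m T)) + de * hsnorm2 T.
  rewrite -[LHS]Re_real hsnorm2E adjmxM trmxCK -mulmxA mxtrace_mulC -mulmxA.
  rewrite -mulmxA -SE mulmxA mulmxDr mxtraceD -PE mul_mx_scalar linearZ /=.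
  by rewrite ReD -hsnorm2E ReZ Re_real.
have twist_linear (F : 'M[V]_(n + n) -> C) : linear_form F ->
    linear_form (fun x => F (sandwich (si^t*) x si)).
  by move=> Flin c x y; rewrite sandwichD sandwichZ Flin.
have [f fE] := functional_of_surj (twist_linear F1 F1lin).
have [g gE] := functional_of_surj (twist_linear F2 F2lin).
have pairE m (X Y : 'M[C]_(m, n + n)) (v : 'M[V]_m) :
    functional_of (f \- g) (sandwich (X^t*) v Y) =
    F1 (sandwich ((X *m si)^t*) v (Y *m si)) -
    F2 (sandwich ((X *m si)^t*) v (Y *m si)).
  by rewrite functional_ofB fE gE sandwich_comp adjmxM.
exists (n + n)%N, f, g; split=> //.
- by apply/(completely_positiveP _ N0) => x x0; rewrite fE; apply: F1ge0; exact: pos_sandwich.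
- by apply/(completely_positiveP _ N0) => x x0; rewrite gE; apply: F2ge0; exact: pos_sandwich.
- move=> r v r0 Lv; rewrite mx_pairingB; apply/opnorm_pairingP => // X Y.
  rewrite pairE mul1r; apply: le_trans (bound _ _ _ _ r0 Lv) _.
  have PD x y : P (x + y) = P x + P y.
    by have := Plin 1 x y; rewrite scale1r mul1r.
  have XE (Z : 'M[C]_(r, n + n)) : Re (P ((Z *m si)^t* *m (Z *m si))) <= hsnorm2 Z.
    have -> : hsnorm2 Z = hsnorm2 (Z *m si *m S^t*).
      by rewrite -mulmxA siS mulmx1.
    by rewrite hsP lerDl mulr_ge0 ?hsnorm2_ge0 // ltW.
  by rewrite PD ReD lerD.
- rewrite ltNge mx_pairingB; apply/negP => /(opnorm_pairingP _ _ t0).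
  move=> /(_ (corner1 n *m S^t*) (corner2 n *m S^t*)).
  rewrite pairE -!mulmxA Ssi !mulmx1 -/(offdiag_embedding a) leNgt => /negP; apply.
  apply: lt_le_trans target.
  have -> : hsnorm2 (corner1 n *m S^t*) + hsnorm2 (corner2 n *m S^t*) =
      Re (P 1%:M) + de * N.
    rewrite !hsP addrACA -ReD -mulrDr; congr (_ + _ * _).
      by rewrite -corner_sum !PE -mxtraceD -mulmxDl.
    apply: (@complexI R); rewrite rmorphD /= !hsnorm2E -mxtraceD corner_sum.
    by rewrite mxtrace1 rmorph_nat.
  rewrite mulrDr ltrD2l /de.
  have -> : t * (ga / (t * N + 1) * N) = ga * (t * N) / (t * N + 1) by ring.
  by rewrite ltr_pdivrMr // ltr_pM2l // ltrDl.
Qed.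

End SeparatingMaps.

(** * From completely positive maps to states *)

Section Normalization.
Context {R : realType} {V : matrixOrderUnitSpace R}.
Local Notation C := R[i].
Local Notation Re := (@complex.Re R).
Local Notation star := (@mou_star R V).
Local Notation pos := (@mou_pos R V _).
Local Notation e := (@mou_unit R V).

Lemma completely_positive_unit r (f : {linear V -> 'M[C]_r}) :
  (0 < r)%N -> completely_positive f -> psdmx (f e).
Proof.
move=> r0 fcp x.
have := functional_of_amp_ge0 r0 fcp (psdmx_gram (x^T)).
rewrite functional_of_amp -mxtrace_tr !trmx_mul !trmxK map_trmx.
by rewrite mulmxA mxtrace_mulC mulmxA trace_mx11.
Qed.

(** Every [y + y^*] is bounded below by a multiple of the unit, on which the
    functional vanishes. *)
Lemma functional_of_eq0 r (f : {linear V -> 'M[C]_r}) x :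
  (0 < r)%N -> completely_positive f -> f e = 0 -> functional_of f x = 0.
Proof.
move=> r0 fcp fe0; have f0 := (completely_positiveP f r0).1 fcp.
have Re0 y : 0 <= Re (functional_of f y).
  have [t t0 /f0] := matrix_order_unit y r0.
  rewrite functional_ofD functional_of_amp fe0 trmx0 mulmx0 mxtrace0 add0r.
  rewrite functional_ofD functional_of_star // => /ge0_Re.
  by rewrite ReD Re_conjc -mulr2n pmulrn_lge0.
have := Re0 x; have := Re0 (- x); have := Re0 (scalesmx 'i%C x).
have := Re0 (scalesmx (- 'i%C) x).
rewrite -[- x]scaleN1smx !functional_ofZ mulN1r.
case: (functional_of f x) => a b /=.
rewrite !mul0r !mul1r !mulN1r => h1 h2 h3 h4.
by apply/eqP; rewrite eq_complex /=; apply/andP; split; apply/eqP; lra.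
Qed.

(** If [M = T^* T], the argument of [f] is a sum of compressions of [x] to
    single elements by the rows of [T]. This makes [v |-> tr (f v) M] completely
    positive. *)
Lemma mxtrace_completely_positive_ge0 r (f : {linear V -> 'M[C]_r})
    (M : 'M[C]_r) (x : 'M[V]_r) :
  (0 < r)%N -> completely_positive f -> psdmx M -> pos x ->
  0 <= \tr (f (\sum_k \sum_l M k l *: x k l)).
Proof.
move=> r0 fcp /psdmx_factor[T ->] x0; set y := \sum_k _.
have y0 : pos (y%:M : 'M[V]_1).
  have -> : (y%:M : 'M[V]_1) =
      \sum_m sandwich (((row m T)^T)^t*) x ((row m T)^T).
    apply/matrixP => i j; rewrite !ord1 mxE mulr1n summxE.
    rewrite /y; under [LHS]eq_bigr => k _ do
      under eq_bigr => l _ do rewrite mxE scaler_suml.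
    under [LHS]eq_bigr => k _ do rewrite exchange_big.
    rewrite exchange_big; apply: eq_bigr => m _.
    rewrite sandwichE exchange_big; apply: eq_bigr => k _.
    by apply: eq_bigr => l _; rewrite !mxE.
  elim/big_ind: _ => [|u v|m _]; [exact: pos0|exact: posD|exact: pos_sandwich].
have yr : pos (y%:M : 'M[V]_r).
  have -> : (y%:M : 'M[V]_r) =
      \sum_k sandwich ((delta_mx 0 k : 'rV[C]_r)^t*) (y%:M : 'M_1) (delta_mx 0 k).
    rewrite [LHS]sandwich_delta; apply: eq_bigr => k _; rewrite (bigD1 k) //=.
    rewrite big1 ?addr0 => [|l lk]; last first.
      by rewrite mxE eq_sym (negbTE lk) mulr0n raddf0 sandwich0.
    by rewrite trmx_delta map_delta_mx mxE eqxx mulr1n.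
  elim/big_ind: _ => [|u v|m _]; [exact: pos0|exact: posD|exact: pos_sandwich].
have := (completely_positiveP f r0).1 fcp _ yr; congr (0 <= _).
apply: eq_bigr => k _; rewrite (bigD1 k) //= mxE eqxx mulr1n big1 ?addr0 //.
by move=> l lk; rewrite mxE eq_sym (negbTE lk) mulr0n raddf0 mxE.
Qed.

(** Scale by a [c] so small that [1 - c f(e)] is positive, and add to both maps
    [(1 - c f(e)) s], where [s] is the state [tr f / tr f(e)]. *)
Lemma ex_states r (f g : {linear V -> 'M[C]_r}) :
  (0 < r)%N -> completely_positive f -> completely_positive g ->
  f e = g e -> f e <> 0 ->
  exists (c : R) (phi psi : {linear V -> 'M[C]_r}),
    [/\ 0 < c, matrix_state phi, matrix_state psi &
      forall v, phi v - psi v = c%:C *: (f v - g v)].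
Proof.
move=> r0 fcp gcp fg fe0; have Bpsd := completely_positive_unit r0 fcp.
set B := f e in fg fe0 Bpsd.
have [T BT] := psdmx_factor Bpsd.
have trB : \tr B = (hsnorm2 T)%:C by rewrite BT -hsnorm2E.
have T0 : 0 < hsnorm2 T.
  rewrite lt_neqAle hsnorm2_ge0 andbT eq_sym; apply/eqP => /hsnorm2_eq0 T0.
  by apply: fe0; rewrite BT T0 mulmx0.
have trB0 : \tr B != 0 by rewrite trB fmorph_eq0 gt_eqF.
pose K := opnorm B + 1; have K0 : 0 < K by rewrite ltr_wpDl ?opnorm_ge0.
pose c := K^-1; have c0 : 0 < c by rewrite invr_gt0.
pose M := 1%:M - c%:C *: B.
have Mpsd : psdmx M.
  move=> x; have := (opnorm_formP B (opnorm_ge0 B)).1 (lexx _) x x.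
  have := Bpsd x; rewrite -!/(mxform _ x x) /M mxformD mxformN mxformZ mxform1.
  move: (mxform B x x) => z /ger0_Im; case: z => a b /= -> xx.
  have x0 := hsnorm2_ge0 x.
  have -> : (hsnorm2 x)%:C - c%:C * (a +i* 0) = (hsnorm2 x - c * a)%:C.
    by apply/eqP; rewrite eq_complex /= !mul0r !mulr0 !subr0 addr0 oppr0 addr0 !eqxx.
  rewrite ler0c subr_ge0 /c ler_pdivrMl // /K.
  by rewrite mulrDl mul1r; lra.
have normalize (h : {linear V -> 'M[C]_r}) : completely_positive h -> h e = B ->
    exists2 phi : {linear V -> 'M[C]_r}, matrix_state phi &
      forall v, phi v = c%:C *: h v + (\tr (f v) / \tr B) *: M.
  move=> hcp he.
  have [|phi phiE] := @ex_linear _ _ r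
      (fun v => c%:C *: h v + (\tr (f v) / \tr B) *: M).
    move=> a u v; rewrite !linearP /= mulrDl scalerDl !scalerDr !scalerA.
    by rewrite [LHS]addrACA [c%:C * a]mulrC mulrA.
  have phicp : completely_positive phi.
    apply/(completely_positiveP _ r0) => x x0.
    have -> : functional_of phi x = c%:C * functional_of h x +
        \tr (f (\sum_k \sum_l M k l *: x k l)) / \tr B.
      rewrite linear_sum linear_sum mulr_suml /functional_of phiE mulr_sumr.
      rewrite -big_split; apply: eq_bigr => k _; rewrite !linear_sum mulr_suml.
      rewrite mulr_sumr -big_split; apply: eq_bigr => l _.
      rewrite mxE [X in X + _ = _]mxE [X in _ + X = _]mxE; congr (_ + _).
      by rewrite !linearZ /= mulrC mulrA.
    apply: addr_ge0; apply: mulr_ge0.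
    - by rewrite ler0c ltW.
    - by apply: ((completely_positiveP h r0).1 hcp).
    - exact: (mxtrace_completely_positive_ge0 r0 fcp Mpsd x0).
    - by rewrite invr_ge0 trB ler0c ltW.
  have phie : phi e = 1%:M.
    by rewrite phiE he divff // scale1r /M addrC subrK.
  exists phi; last by move=> v; rewrite phiE.
  split=> //; exists 1 => n a n0; rewrite mul1r.
  exact: opnorm_pairing_le_mnorm.
have [phi phist phiE] := normalize f fcp erefl.
have [psi psist psiE] := normalize g gcp (esym fg).
exists c, phi, psi; split=> // v.
by rewrite phiE psiE opprD addrACA subrr addr0 -scalerBr.
Qed.

End Normalization.

(** * The Lipschitz seminorm of the metric *)

Section Duality.
Context {R : realType} {V : matrixOrderUnitSpace R} (L : forall n, 'M[V]_n -> R).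
Local Notation C := R[i].
Local Notation Re := (@complex.Re R).
Local Notation e := (@mou_unit R V).
Hypothesis mlsL : matrix_lipschitz_seminorm L.

Definition pairing_dist r (f g : {linear V -> 'M[C]_r}) n (a : 'M[V]_n) : R :=
  opnorm (mx_pairing f a - mx_pairing g a).

Lemma opnormZ m n (t : R) (A : 'M[C]_(m, n)) : 0 <= t ->
  opnorm (t%:C *: A) = t * opnorm A.
Proof.
have le_scale (s : R) (B : 'M[C]_(m, n)) : 0 <= s ->
    opnorm (s%:C *: B) <= s * opnorm B.
  move=> s0; apply: opnorm_le => [|x]; first by rewrite mulr_ge0 ?opnorm_ge0.
  rewrite -scalemxAl hsnorm2Z [Normc.normc _]/= expr0n addr0.
  rewrite sqr_sqrtr ?sqr_ge0 // exprMn -[leRHS]mulrA ler_wpM2l ?sqr_ge0 //.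
  exact: hsnorm2_mulmx_le.
rewrite le_eqVlt => /predU1P[<-|t0].
  by apply/eqP; rewrite eq_le le_scale // mul0r opnorm_ge0.
apply/eqP; rewrite eq_le; apply/andP; split; first exact/le_scale/ltW.
rewrite -ler_pdivlMl //.
have AE : A = t^-1%:C *: (t%:C *: A).
  by rewrite scalerA -rmorphM mulVf ?gt_eqF // rmorph1 scale1r.
by rewrite {1}AE; apply: le_scale; rewrite invr_ge0 ltW.
Qed.

Lemma pairing_distZ r (f g : {linear V -> 'M[C]_r}) n (a : 'M[V]_n) (t : R) :
  0 <= t -> pairing_dist f g (scalesmx t%:C a) = t * pairing_dist f g a.
Proof.
move=> t0; rewrite /pairing_dist -(opnormZ _ t0); congr opnorm.
by apply/matrixP => i j; rewrite !mxE !linearZ !mxE mulrBr.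
Qed.

Lemma pairing_dist_amp r (f g : {linear V -> 'M[C]_r}) n (A : 'M[C]_n) :
  f e = g e -> pairing_dist f g (ampmx e A) = 0.
Proof.
move=> fg; rewrite /pairing_dist (_ : _ - _ = 0).
  by apply/eqP; rewrite eq_le opnorm_ge0 andbT; apply: opnorm_le => // x;
    rewrite mul0mx hsnorm2_0 expr0n mul0r.
by apply/matrixP => i j; rewrite !mxE !linearZ /= fg subrr.
Qed.

Lemma mx_pairing1 r (f : V -> 'M[C]_r) v k l :
  mx_pairing f (v%:M : 'M_1) (mxtens_index (0, k)) (mxtens_index (0, l)) = f v k l.
Proof. by rewrite mxE !mxtens_indexK /= mxE mulr1n. Qed.

Lemma pairing_dist1_gt0 r (f g : {linear V -> 'M[C]_r}) v :
  f v <> g v -> 0 < pairing_dist f g (v%:M : 'M_1).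
Proof.
move=> fgv; rewrite lt_neqAle opnorm_ge0 andbT eq_sym; apply/eqP => d0.
have /eqP := opnorm0_eq0 (eq_ind_r (fun x => x <= 0) (lexx 0) d0).
rewrite subr_eq0 => /eqP/matrixP fg; apply: fgv; apply/matrixP => k l.
by rewrite -!mx_pairing1 fg.
Qed.

Lemma lipschitz_eq0 n (a : 'M[V]_n) : (0 < n)%N -> L a = 0 ->
  exists A, a = ampmx e A.
Proof. by move=> n0 /(mls_null mlsL a n0). Qed.

Lemma lipschitz_ge0 n (a : 'M[V]_n) : (0 < n)%N -> 0 <= L a.
Proof. by move=> n0; have [] := mls_seminorm mlsL n0. Qed.

Lemma lipschitzZ n (a : 'M[V]_n) (t : R) : (0 < n)%N -> 0 <= t ->
  L (scalesmx t%:C a) = t * L a.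
Proof.
move=> n0 t0; have [_ _ ->] := mls_seminorm mlsL n0.
by rewrite /= expr0n addr0 sqrtr_sqr ger0_norm.
Qed.

Lemma le_nneg_sup (A : set (\bar R)) x : A x -> (x <= nneg_sup A)%E.
Proof. by move=> Ax; rewrite le_max ereal_sup_ubound ?orbT. Qed.

Lemma nneg_sup_le (A : set (\bar R)) M :
  (0 <= M)%E -> (forall x, A x -> (x <= M)%E) -> (nneg_sup A <= M)%E.
Proof. by move=> M0 AM; rewrite ge_max M0 ge_ereal_sup. Qed.

Lemma nneg_sup_ge0 (A : set (\bar R)) : (0 <= nneg_sup A)%E.
Proof. by rewrite le_max lexx. Qed.

(** By homogeneity when [L a] is positive; otherwise [a] is a matrix of multiples
    of the unit. *)
Lemma pairing_dist_le_metric r (f g : {linear V -> 'M[C]_r}) n (a : 'M[V]_n) :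
  (0 < n)%N -> f e = g e ->
  matrix_metric L f g = +oo%E \/ exists2 d : R, matrix_metric L f g = d%:E &
    pairing_dist f g a <= d * L a.
Proof.
move=> n0 fg; have := nneg_sup_ge0 [set x | exists n (a : 'M[V]_n),
  [/\ (0 < n)%N, L a <= 1 & x = (pairing_dist f g a)%:E]].
rewrite -/(matrix_metric L f g); case DE : (matrix_metric L f g) => [d||] // _;
  last by left.
right; exists d => //.
have [/(lipschitz_eq0 n0)[A ->]|La0] := eqVneq (L a) 0.
  rewrite pairing_dist_amp // mulr_ge0 ?lipschitz_ge0 //.
  by rewrite -lee_fin -DE; apply: nneg_sup_ge0.
have La : 0 < L a by rewrite lt_neqAle eq_sym La0 lipschitz_ge0.
have Li : 0 <= (L a)^-1 by rewrite invr_ge0 ltW.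
have : ((pairing_dist f g (scalesmx (L a)^-1%:C a))%:E <= d%:E)%E.
  rewrite -DE; apply: le_nneg_sup; exists n, (scalesmx (L a)^-1%:C a).
  by split=> //; rewrite (lipschitzZ _ n0 Li) mulVf.
by rewrite lee_fin (pairing_distZ _ _ _ Li) ler_pdivrMl // mulrC.
Qed.

Lemma metric_gt0 r (f g : {linear V -> 'M[C]_r}) :
  f e = g e -> f <> g :> (V -> 'M[C]_r) -> (0 < matrix_metric L f g)%E.
Proof.
move=> fg fNg; have [v fgv] : exists v, f v <> g v.
  apply: contrapT => nv; apply: fNg; apply/funext => v.
  by apply: contrapT => fgv; apply: nv; exists v.
have [->//|[d -> ]] := pairing_dist_le_metric (v%:M : 'M_1) isT fg.
move/(lt_le_trans (pairing_dist1_gt0 fgv)); rewrite lte_fin.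
by apply: contraTT; rewrite -!leNgt => d0; rewrite mulr_le0_ge0 ?lipschitz_ge0.
Qed.

Lemma lipschitz_of_metric_le n (a : 'M[V]_n) : (0 < n)%N ->
  (lipschitz_of_metric (matrix_metric L) a <= (L a)%:E)%E.
Proof.
move=> n0; apply: nneg_sup_le; first by rewrite lee_fin lipschitz_ge0.
move=> _ [r [f [g [r0 [_ _ fe] [_ _ ge] fNg ->]]]].
have fg : f e = g e by rewrite fe ge.
have := metric_gt0 fg fNg.
have [->|[d -> da]] := pairing_dist_le_metric a n0 fg.
  by rewrite invey mule0 lee_fin lipschitz_ge0.
rewrite lte_fin => d0; rewrite inver gt_eqF // -EFinM lee_fin.
by rewrite ler_pdivrMr // mulrC.
Qed.

(** Since [L] vanishes on all multiples of the unit, the distance is bounded on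
    a whole line. *)
Lemma agree_on_unit r (f g : {linear V -> 'M[C]_r}) :
  (forall m (v : 'M[V]_m), (0 < m)%N -> L v <= 1 -> pairing_dist f g v <= 1) ->
  f e = g e.
Proof.
move=> bound; apply: contrapT => /pairing_dist1_gt0 d0.
set d := pairing_dist _ _ _ in d0.
have Le : L (e%:M : 'M_1) = 0.
  apply: (mls_null mlsL (e%:M : 'M_1) isT).2; exists 1%:M; rewrite -/(ampmx e 1%:M).
  by rewrite -scalar_ampmx scale1r.
have t0 : 0 <= 2 / d by rewrite divr_ge0 ?ltW.
have := bound 1%N (scalesmx (2 / d)%:C e%:M) isT.
rewrite lipschitzZ // Le mulr0 ler01 => /(_ isT); rewrite pairing_distZ // -/d.
by rewrite divfK ?gt_eqF // leNgt ltr1n.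
Qed.

Lemma lipschitz_of_metric_ge n (a : 'M[V]_n) :
  lower_semicontinuous_seminorm L -> (0 < n)%N ->
  ((L a)%:E <= lipschitz_of_metric (matrix_metric L) a)%E.
Proof.
move=> lsc n0; rewrite leNgt; apply/negP.
have : (0 <= lipschitz_of_metric (matrix_metric L) a)%E by exact: nneg_sup_ge0.
case lipE : (lipschitz_of_metric (matrix_metric L) a) => [t||] //.
rewrite lee_fin lte_fin => t0 ta.
have [N [f [g [N0 fcp gcp bound fga]]]] := separating_maps mlsL lsc n0 t0 ta.
have fg := agree_on_unit bound.
have fe0 : f e <> 0.
  move=> fe0; have ge0 : g e = 0 by rewrite -fg.
  move: fga; rewrite ltNge => /negP; apply; apply: le_trans t0.
  rewrite mx_pairingB; apply/opnorm_pairingP => // X Y.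
  by rewrite functional_ofB !functional_of_eq0 // subrr mulr0 mul0r.
have [c [phi [psi [c0 phist psist phipsi]]]] := ex_states N0 fcp gcp fg fe0.
have distE m (v : 'M[V]_m) : pairing_dist phi psi v = c * pairing_dist f g v.
  rewrite /pairing_dist -(opnormZ _ (ltW c0)); congr opnorm.
  apply/matrixP => i j; rewrite !mxE.
  have /matrixP := phipsi (v (mxtens_unindex i).1 (mxtens_unindex j).1).
  by move=> /(_ (mxtens_unindex i).2 (mxtens_unindex j).2); rewrite !mxE.
have [_ _ phie] := phist; have [_ _ psie] := psist.
have uu : phi e = psi e by rewrite phie psie.
have phiNpsi : phi <> psi :> (V -> 'M[C]_N).
  move=> eq; have : 0 < pairing_dist phi psi a.
    by rewrite distE mulr_gt0 // (le_lt_trans t0).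
  rewrite /pairing_dist eq subrr ltNge => /negP; apply.
  by apply: opnorm_le => // x; rewrite mul0mx hsnorm2_0 expr0n mul0r.
have Dle : (matrix_metric L phi psi <= c%:E)%E.
  apply: nneg_sup_le; first by rewrite lee_fin ltW.
  move=> _ [m [v [m0 Lv ->]]]; rewrite lee_fin -/(pairing_dist phi psi v) distE.
  by rewrite -[leRHS]mulr1; apply: ler_wpM2l; [exact: ltW|exact: bound].
have D0 := metric_gt0 uu phiNpsi.
case DE : (matrix_metric L phi psi) Dle D0 => [d||] //.
rewrite lee_fin lte_fin => dc d0.
have : ((pairing_dist phi psi a)%:E / matrix_metric L phi psi <= t%:E)%E.
  by rewrite -lipE; apply: le_nneg_sup; exists N, phi, psi.
rewrite DE inver gt_eqF // -EFinM lee_fin ler_pdivrMr // distE.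
apply/negP; rewrite -ltNge.
apply: le_lt_trans (_ : t * c < _); first by rewrite ler_wpM2l.
by rewrite mulrC ltr_pM2l.
Qed.

End Duality.

Theorem theorem4p4 (R : realType) (V : matrixOrderUnitSpace R)
    (L : forall n : nat, 'M[V]_n -> R) :
  matrix_lipschitz_seminorm L ->
  lower_semicontinuous_seminorm L ->
  forall (n : nat) (a : 'M[V]_n), (0 < n)%N ->
    lipschitz_of_metric (matrix_metric L) a = (L n a)%:E.
Proof.
move=> mlsL lsc n a n0; apply/eqP; rewrite eq_le lipschitz_of_metric_le //.
exact: lipschitz_of_metric_ge.
Qed.
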